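(* Fix $a>-1$. For any fixed integer $k\ge1$, as $\mu\to\infty$, $$\mathbb{P}\big[\mathcal{M}_a([\mu,\infty))\ge k\big]=\exp\Big(-\frac{k(|a|+k)}{2}\,\mu\,(1+o(1))\Big).$$
   Context: The process $\mathcal{M}_a$, $a>-1$. Let $B$ be a standard Brownian motion. For $\delta\in\mathbb{R}$, $s\ge0$ let $Y^{\delta,s}(t)=\delta(t-s)+B(t)-B(s)$ and $$R^{(\delta,s)}(t)=Y^{\delta,s}(t)+\sup_{s\le u\le t}\max(0,-Y^{\delta,s}(u)),\quad t\ge s,$$ the Brownian motion with drift $\delta$ reflected at $0$, started from $0$ at time $s$. For $\mu>0$ let $c_\mu(t)=\mu+t/4$. Set $\xi^+_\mu(0)=0$ and, for $i\ge1$, $$\xi^-_\mu(i)=\inf\{t\ge\xi^+_\mu(i-1):R^{(-a/4,\,\xi^+_\mu(i-1))}(t)=c_\mu(t)\},\qquad \xi^+_\mu(i)=\inf\{t\ge\xi^-_\mu(i):R^{((a+1)/4,\,\xi^-_\mu(i))}(t)=c_\mu(t)\},$$ with $\inf\emptyset=\infty$ (and all later times equal to $\infty$). Let $\nu_\mu=\sum_{i\ge1}\delta_{\xi^+_\mu(i)}$ (sum over finite times only); the total mass $\nu_\mu(\mathbb{R}_+)$ is a.s. finite and non-increasing in $\mu$. The point process $\mathcal{M}_a$ on $(0,\infty)$ is defined by $\mathcal{M}_a([\mu,\infty))=\nu_\mu(\mathbb{R}_+)$ for all $\mu>0$. *)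

(* Defs.v *)
From HB Require Import structures.
From mathcomp Require Import all_boot all_order all_algebra.
From mathcomp Require Import all_classical all_reals all_analysis.
Import Order.TTheory GRing.Theory Num.Theory.
Import numFieldNormedType.Exports.

Set Implicit Arguments.
Unset Strict Implicit.
Unset Printing Implicit Defensive.

Local Open Scope classical_set_scope.
Local Open Scope ring_scope.

(* Only the times [t >= 0] matter: nothing is required of [B t] for [t < 0].
   Strict inequality [s < t] in the Gaussian clause is needed because
   [normal_prob 0 0] is not the Dirac mass at 0 in the library.  In the
   independence clause, [A i] may be the whole line, so the product rule also
   holds for subfamilies. *)
Record standard_BM (R : realType) (d : measure_display) (T : measurableType d)
    (P : probability T R) (B : R -> {RV P >-> R}) : Prop := StandardBM {
  BM_start : {ae P, forall w, B 0 w = 0} ;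
  BM_continuous : {ae P, forall w,
    {within `[0, +oo[, continuous (fun t : R => B t w)}} ;
  BM_gaussian : forall (s t : R) (A : set R), 0 <= s -> s < t -> measurable A ->
    P ((B t \- B s) @^-1` A) = normal_prob 0 (Num.sqrt (t - s)) A ;
  BM_independent : forall (n : nat) (t : nat -> R) (A : nat -> set R),
    0 <= t 0%N -> (forall i, (i < n)%N -> t i <= t i.+1) ->
    (forall i, measurable (A i)) ->
    P (\bigcap_(i in `I_n) ((B (t i.+1) \- B (t i)) @^-1` A i)) =
    (\prod_(i < n) P ((B (t i.+1) \- B (t i))%R @^-1` A i))%E }.

Section paths.
Variables (R : realType) (b : R -> R).

(* Y^{delta,s}, along the sample path [b] *)
Definition drifted (delta s t : R) : R := delta * (t - s) + b t - b s.

(* R^{(delta,s)} *)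
Definition reflected (delta s t : R) : R :=
  drifted delta s t +
  sup [set Num.max 0 (- drifted delta s u) | u in `[s, t]].

Definition barrier (mu t : R) : R := mu + t / 4.

(* First time after [s] at which the reflected path started from 0 at time [s]
   meets the barrier; it is +oo if there is none ([ereal_inf set0 = +oo]) or if
   [s] is already infinite. *)
Definition hitting_time (delta mu : R) (s : \bar R) : \bar R :=
  if s is r%:E then
    ereal_inf (EFin @` [set t | r <= t /\ reflected delta r t = barrier mu t])
  else +oo%E.

(* xi^+_mu(i); the inner hitting time is xi^-_mu(i) *)
Fixpoint xi_plus (a mu : R) (i : nat) : \bar R :=
  if i is j.+1 then
    let xi_minus := hitting_time (- a / 4) mu (xi_plus a mu j) in
    hitting_time ((a + 1) / 4) mu xi_minus
  else 0%:E.

Definition nu (a mu : R) (A : set R) : \bar R :=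
  (\sum_(1 <= i <oo | xi_plus a mu i \is a fin_num)
     \d_(fine (xi_plus a mu i)) A)%E.

End paths.

(* A kernel from [T] to the line is a random measure: [M w] is a measure and
   [w |-> M w A] is measurable.  A point process on (0, +oo) does not charge
   ]-oo, 0] and takes finite integer values on sets bounded away from 0 and
   from +oo. *)
Definition point_process_pos (R : realType) (d : measure_display)
    (T : measurableType d) (M : R.-ker T ~> R) : Prop :=
  forall w : T, M w `]-oo, 0]%classic = 0%E /\
    forall (x y : R) (A : set R), 0 < x -> measurable A -> A `<=` `[x, y] ->
      exists n : nat, M w A = n%:R%:E.

(* The point process M_a driven by B: M_a([mu, +oo)) is the total mass of
   nu_mu for all mu > 0.  The identity can only be asked for almost surely,
   since the total masses are finite and non-increasing in mu only almost
   surely. *)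
Definition is_Ma (R : realType) (d : measure_display) (T : measurableType d)
    (P : probability T R) (B : R -> {RV P >-> R}) (a : R)
    (M : R.-ker T ~> R) : Prop :=
  point_process_pos M /\
  {ae P, forall w, forall mu : R, 0 < mu ->
    M w `[mu, +oo[%classic = nu (fun t => B t w) a mu `[0, +oo[%classic}.

(* Main.v *)
(* Let [theta i] be the slope of the driving path in the [i]-th stage of the
   cheapest scenario. Up to the time [t], a path started in a stage from 0 has to
   gain [mu + t / 4], less what its drift [delta i] provides, and raising the
   hitting time of a stage raises all later barriers as well. Duality turns the
   optimization over the hitting times into the equations
   [theta i ^ 2 / 2 + theta i * delta i = V i / 4], [V i = sum_(j >= i) theta j],
   whose explicit solution has [V 0 = k (|a| + k) / 2].

   Lower bound: the reflected path at [t] started at [s] is the maximum over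
   [u] in [[s, t]] of the drifted increment over [[u, t]]. So if the drifted
   increments over prescribed intervals [[t i, t i.+1]] all exceed the barrier,
   the [i]-th hitting time is at most [t i], whatever the actual hitting times
   are. These increments are independent Gaussians.

   Upper bound: if all hitting times [s i] are finite, there are [u i] in
   [[s i, s i.+1]] such that the increments over [[u i, s i.+1]] meet the barrier
   exactly. Up to the oscillations over unit intervals, these times may be taken
   to be integers. Chernoff's bound with the tilts [theta i] for the disjoint,
   hence independent, increments and a union bound give the result. *)

Require Import Defs.
From HB Require Import structures.
From mathcomp Require Import all_boot all_order all_algebra.
From mathcomp Require Import all_classical all_reals all_analysis.
From mathcomp Require Import measurable_realfun.
From mathcomp Require Import ring lra zify.
Import Order.TTheory GRing.Theory Num.Theory.
Import numFieldNormedType.Exports.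
Local Open Scope classical_set_scope.
Local Open Scope ring_scope.

(** * Reflected paths *)

Lemma within_continuousP (R : realType) (A : set R) (f : R -> R) :
  {within A, continuous f} <->
  forall x, A x -> forall e, 0 < e ->
    exists2 r, 0 < r & forall y, A y -> `|x - y| < r -> `|f x - f y| < e.
Proof.
split=> [/subspace_continuousP cf x Ax e e0|cf].
  have /cvgrPdist_lt/(_ e e0) := cf x Ax.
  rewrite near_withinE => /nbhs_ballP[r /= r0 rP].
  by exists r => // y Ay xy; apply: rP.
apply/subspace_continuousP => x Ax; apply/cvgrPdist_lt => e e0.
have [r r0 rP] := cf x Ax e e0.
rewrite near_withinE; apply/nbhs_ballP; exists r => //= y xy Ay.
exact: rP.
Qed.

Section reflected_paths.
Context {R : realType}.
Implicit Types (b : R -> R) (delta mu s t u x y : R).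

Lemma within_drifted b delta s x y : 0 <= x ->
  {within `[0, +oo[, continuous b} ->
  {within `[x, y], continuous (drifted b delta s)}.
Proof.
move=> x0 /within_continuousP cb; apply/within_continuousP => z /=.
rewrite in_itv /= => /andP[xz zy] e e0.
have [|r r0 rP] := cb z _ (e / 2) ltac:(by rewrite divr_gt0).
  by rewrite /= in_itv /= andbT (le_trans x0).
pose K := `|delta| + 1.
have K0 : 0 < K by rewrite ltr_wpDl.
exists (Num.min r (e / 2 / K)); first by rewrite lt_min r0 !divr_gt0.
move=> w /=; rewrite in_itv /= => /andP[xw wy].
rewrite lt_min => /andP[/rP zr zK].
have -> : drifted b delta s z - drifted b delta s w =
  delta * (z - w) + (b z - b w) by rewrite /drifted; ring.
rewrite (le_lt_trans (ler_normD _ _))// [ltRHS](splitr e) ler_ltD//; last first.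
  by apply: zr; rewrite /= in_itv /= andbT (le_trans x0).
rewrite normrM; move: zK; rewrite ltr_pdivlMr// => /ltW; apply: le_trans.
by rewrite mulrC ler_wpM2l// lerDl.
Qed.

Lemma within_driftedN b delta s x y : 0 <= x ->
  {within `[0, +oo[, continuous b} ->
  {within `[x, y], continuous (fun u => - drifted b delta s u)}.
Proof.
move=> x0 cb; move/within_continuousP: (within_drifted b delta s x y x0 cb) => c.
apply/within_continuousP => z xz e e0; have [r r0 rP] := c z xz e e0.
by exists r => // w xw zw; rewrite -opprD normrN rP.
Qed.

(* [R^{(delta,s)}(t)] is the maximum over [u] in [[s, t]] of the increment of the
   drifted path over [[u, t]]; the other half is [reflected_ge]. *)
Lemma reflected_attained b delta s t : {within `[0, +oo[, continuous b} ->
  0 <= s -> s <= t ->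
  exists2 u, s <= u <= t & reflected b delta s t = delta * (t - u) + b t - b u.
Proof.
move=> cb s0 st.
have cN := within_driftedN b delta s s t s0 cb.
have [u] := EVT_max st cN; rewrite in_itv /= => sut uP; exists u => //.
have u0 : 0 <= - drifted b delta s u.
  by have := uP s; rewrite in_itv /= lexx st /drifted => /(_ isT); lra.
have -> : reflected b delta s t = drifted b delta s t - drifted b delta s u.
  congr (_ + _); apply/eqP; rewrite eq_le; apply/andP; split.
    apply: ge_sup; first by exists (Num.max 0 (- drifted b delta s u)); exists u.
    by move=> _ [v /= sv <-]; rewrite ge_max u0 uP.
  apply: ub_le_sup; last first.
    by exists u => //; apply/max_idPr.
  exists (- drifted b delta s u) => _ [v /= sv <-].
  by rewrite ge_max u0 uP.
by rewrite /drifted; ring.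
Qed.

Lemma reflected_ge b delta s t u : {within `[0, +oo[, continuous b} ->
  0 <= s -> s <= u <= t ->
  delta * (t - u) + b t - b u <= reflected b delta s t.
Proof.
move=> cb s0 /andP[su ut].
have -> : delta * (t - u) + b t - b u =
  drifted b delta s t - drifted b delta s u by rewrite /drifted; ring.
rewrite lerD2l; set S := (X in sup X).
have St : S (Num.max 0 (- drifted b delta s u)).
  by exists u => //=; rewrite in_itv /= su.
apply: le_trans (ub_le_sup _ St); first by rewrite le_max lexx orbT.
(* The supremum is meaningful only for a bounded set; continuity supplies the bound. *)
have cN := within_driftedN b delta s s t s0 cb.
have [v _ vP] := EVT_max (le_trans su ut) cN.
exists (Num.max 0 (- drifted b delta s v)) => _ [w /= sw <-].
by rewrite ge_max !le_max lexx vP// orbT.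
Qed.

Lemma within_reflected b delta s t : {within `[0, +oo[, continuous b} ->
  0 <= s -> {within `[s, t], continuous (reflected b delta s)}.
Proof.
move=> cb s0.
pose g := drifted b delta s.
have gE u v : delta * (v - u) + b v - b u = g v - g u.
  by rewrite /g /drifted; ring.
(* If the maximizer for [y] lies before [x], it also competes at [x]; otherwise the value at [y] is
   an increment of [g] inside [x, y], while the value at [x] is nonnegative. *)
have R_osc x y e : s <= x -> x <= y ->
    (forall z, x <= z <= y -> `|g x - g z| <= e) ->
    `|reflected b delta s x - reflected b delta s y| <= 2 * e.
  move=> sx xy ge.
  have e0 : 0 <= e by apply: le_trans (ge x _); rewrite ?lexx.
  have [u /andP[su ux] Rx] := reflected_attained b delta s x cb s0 sx.
  have [v /andP[sv vy] Ry] := reflected_attained b delta s y cb s0 (le_trans sx xy).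
  have R0 : 0 <= reflected b delta s x.
    by have := reflected_ge b delta s x x cb s0; rewrite sx lexx => /(_ isT); lra.
  have Hy := reflected_ge b delta s y u cb s0 ltac:(by rewrite su (le_trans ux)).
  have := ge y ltac:(by rewrite xy lexx).
  rewrite !gE in Rx Ry Hy; rewrite ler_norml => /andP[g1 g2].
  rewrite ler_norml; apply/andP; split; last by lra.
  have [vx|xv] := leP v x.
    have := reflected_ge b delta s x v cb s0 ltac:(by rewrite sv vx).
    by rewrite gE; lra.
  by have := ge v ltac:(by rewrite vy ltW); rewrite ler_norml => /andP[]; lra.
move/within_continuousP: (within_drifted b delta s s t s0 cb) => c.
apply/within_continuousP => x sx e e0.
have [r r0 rP] := c x sx (e / 8) ltac:(by rewrite divr_gt0).
exists r => // y sy xy.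
move: (sx) (sy); rewrite /= !in_itv /= => /andP[sx' xt] /andP[sy' yt].
have [lexy|ltyx] := leP x y.
  apply: (@le_lt_trans _ _ (2 * (e / 8))); last by lra.
  apply: R_osc => // z /andP[xz zy]; apply/ltW/rP.
    by rewrite /= in_itv /= (le_trans sx' xz) (le_trans zy yt).
  apply: le_lt_trans xy; rewrite ler0_norm ?subr_le0// ler0_norm ?subr_le0//; lra.
(* [R_osc] measures oscillations from the left end, now [y], but continuity is centred at [x]:
   passing through [x] turns [e / 8] into [e / 4]. *)
rewrite distrC; apply: (@le_lt_trans _ _ (2 * (e / 4))); last by lra.
apply: R_osc => //; first exact: ltW.
move=> z /andP[yz zx].
have H w : y <= w <= x -> `|g x - g w| < e / 8.
  move=> /andP[yw wx]; apply: rP.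
    by rewrite /= in_itv /= (le_trans sy' yw) (le_trans wx xt).
  apply: le_lt_trans xy; rewrite ger0_norm ?subr_ge0// ger0_norm ?subr_ge0//; lra.
have := H y; rewrite lexx (ltW ltyx) => /(_ isT).
have := H z; rewrite yz zx => /(_ isT).
rewrite !ltr_norml => /andP[? ?] /andP[? ?].
by rewrite ler_norml; apply/andP; split; lra.
Qed.

Definition hit_set b delta mu r : set R :=
  [set t | r <= t /\ reflected b delta r t = barrier mu t].

Lemma hit_set_lbound b delta mu r :
  lbound (EFin @` hit_set b delta mu r) r%:E.
Proof. by move=> _ [t [rt _] <-]; rewrite lee_fin. Qed.

Lemma hitting_time_ge b delta mu r : (r%:E <= hitting_time b delta mu r%:E)%E.
Proof. exact/le_ereal_inf_tmp/hit_set_lbound. Qed.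

(** Intermediate value theorem: the reflected path starts at 0, strictly below the barrier, so it
    must have met the barrier before being above it. *)
Lemma hitting_time_le b delta mu r t : {within `[0, +oo[, continuous b} ->
  0 < mu -> 0 <= r -> r <= t -> barrier mu t <= reflected b delta r t ->
  (hitting_time b delta mu r%:E <= t%:E)%E.
Proof.
move=> cb mu0 r0 rt Rt.
have cR : {within `[r, t], continuous
    (fun u => reflected b delta r u - barrier mu u)}.
  move/within_continuousP: (within_reflected b delta r t cb r0) => c.
  apply/within_continuousP => x sx e e0.
  have [d d0 dP] := c x sx (e / 2) ltac:(by rewrite divr_gt0).
  exists (Num.min d e); first by rewrite lt_min d0.
  move=> y sy; rewrite lt_min => /andP[/(dP y sy) + +].
  by rewrite !ltr_norml /barrier => /andP[? ?] /andP[? ?]; apply/andP; split; lra.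
have Rr : reflected b delta r r = 0.
  have [u /andP[ru ur] ->] := reflected_attained b delta r r cb r0 (lexx r).
  by have -> : u = r by [apply/eqP; rewrite eq_le ru ur]; ring.
have [|u] := IVT (v := 0) rt cR.
  rewrite Rr ge_min le_max !subr_ge0 Rt orbT andbT; apply/orP; left.
  by rewrite /barrier; lra.
rewrite in_itv /= => /andP[ru ut] /eqP; rewrite subr_eq0 => /eqP Ru.
apply: (@le_trans _ _ u%:E); last by rewrite lee_fin.
by apply: ereal_inf_lbound; exists u.
Qed.

(** By continuity, a positive gap to the barrier at the infimum would exclude hits shortly
    afterwards. *)
Lemma hitting_time_attained b delta mu r : {within `[0, +oo[, continuous b} ->
  0 <= r -> hitting_time b delta mu r%:E \is a fin_num ->
  let t := fine (hitting_time b delta mu r%:E) in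
  r <= t /\ reflected b delta r t = barrier mu t.
Proof.
move=> cb r0 fin t.
have tE : hitting_time b delta mu r%:E = t%:E by rewrite fineK.
have rt : r <= t by rewrite -lee_fin -tE hitting_time_ge.
split=> //; apply/eqP; apply: contraT => Rt.
pose e := `|reflected b delta r t - barrier mu t|.
have e0 : 0 < e by rewrite normr_gt0 subr_eq0.
move/within_continuousP: (within_reflected b delta r (t + 1) cb r0) => c.
have [|d d0 dP] := c t _ (e / 2) ltac:(by rewrite divr_gt0).
  by rewrite /= in_itv /= rt; lra.
(* Within [d], the reflected path moves by less than [e / 2]; within [e], the barrier moves by less
   than [e / 4]; 1 keeps the hit [u] in [r, t + 1]. *)
pose d' := Num.min (Num.min d e) 1.
have d'0 : 0 < d' by rewrite !lt_min d0 e0 ltr01.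
have : (ereal_inf (EFin @` hit_set b delta mu r) < (t + d')%:E)%E.
  by rewrite -[ereal_inf _]/(hitting_time b delta mu r%:E) tE lte_fin; lra.
move=> /ereal_inf_lt[_ [u [ru Ru] <-]]; rewrite lte_fin => utd.
have tu : t <= u.
  by rewrite -lee_fin -tE; apply: ereal_inf_lbound; exists u.
have [d1 d2 d3] : [/\ d' <= d, d' <= e & d' <= 1].
  by rewrite /d' !ge_min !lexx !orbT.
have /dP : u \in `[r, t + 1] by rewrite in_itv /= ru; lra.
rewrite ler0_norm ?subr_le0// => /(_ ltac:(lra)).
have : e <= `|reflected b delta r t - reflected b delta r u| + `|(u - t) / 4|.
  have -> : e = `|reflected b delta r t - reflected b delta r u + (u - t) / 4|.
    by rewrite Ru /e /barrier; congr (`| _ |); ring.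
  exact: ler_normD.
by rewrite [`|(u - t) / 4|]ger0_norm ?divr_ge0 ?subr_ge0//; lra.
Qed.

End reflected_paths.

(** * Successive hitting times *)

Section stages.
Context {R : realType}.
Implicit Types (b : R -> R) (delta : nat -> R) (a mu : R).

(** Interleaves the times [xi_minus] and [xi_plus] in one sequence with one drift per stage, so that
    both bounds can be proved for arbitrary drifts. *)
Fixpoint stage_time b delta mu (i : nat) : \bar R :=
  if i is j.+1 then hitting_time b (delta j) mu (stage_time b delta mu j)
  else 0%:E.

Definition stage_drift a (i : nat) : R := if odd i then (a + 1) / 4 else - a / 4.

Lemma xi_plusE b a mu k :
  xi_plus b a mu k = stage_time b (stage_drift a) mu k.*2.
Proof. by elim: k => //= k ->; rewrite /stage_drift /= odd_double. Qed.

Lemma stage_time_ge0 b delta mu i : (0%:E <= stage_time b delta mu i)%E.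
Proof.
elim: i => //= i; case: (stage_time _ _ _ _) => [r||] //= r0.
exact: le_trans (hitting_time_ge _ _ _ _).
Qed.

Lemma stage_time_finS b delta mu i :
  stage_time b delta mu i.+1 \is a fin_num ->
  stage_time b delta mu i \is a fin_num.
Proof. by rewrite /=; case: (stage_time _ _ _ _). Qed.

Lemma stage_time_finW b delta mu i j : (i <= j)%N ->
  stage_time b delta mu j \is a fin_num ->
  stage_time b delta mu i \is a fin_num.
Proof.
elim: j => [|j IH]; first by rewrite leqn0 => /eqP ->.
by rewrite leq_eqVlt => /predU1P[->//|ij] /stage_time_finS; exact: IH.
Qed.

(** Replaces the reflected paths by increments of [b] over disjoint intervals, to which independence
    applies. *)
Lemma stage_time_chain b delta mu N : {within `[0, +oo[, continuous b} ->
  stage_time b delta mu N \is a fin_num ->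
  exists s u : nat -> R, s 0%N = 0 /\ forall i, (i < N)%N ->
    s i <= u i <= s i.+1 /\
    b (s i.+1) - b (u i) = barrier mu (s i.+1) - delta i * (s i.+1 - u i).
Proof.
move=> cb finN.
pose s i := fine (stage_time b delta mu i).
have sE i : (i <= N)%N -> stage_time b delta mu i = (s i)%:E.
  by move=> iN; rewrite fineK// (stage_time_finW _ _ _ _ _ iN).
have s0 i : 0 <= s i by rewrite fine_ge0// stage_time_ge0.
have H i : exists u, (i < N)%N -> s i <= u <= s i.+1 /\
    b (s i.+1) - b u = barrier mu (s i.+1) - delta i * (s i.+1 - u).
  have [iN|] := ltnP i N; last by exists 0.
  have E : stage_time b delta mu i.+1 = hitting_time b (delta i) mu (s i)%:E.
    by rewrite /= (sE i (ltnW iN)).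
  have := hitting_time_attained b (delta i) mu (s i) cb (s0 i).
  rewrite -E -/(s i.+1) (sE i.+1 iN) => /(_ isT)[le_s Rs].
  have [u us Ru] := reflected_attained b (delta i) _ _ cb (s0 i) le_s.
  by exists u => _; split => //; rewrite -Rs Ru; ring.
have [u uP] := choice H.
by exists s, u.
Qed.

(** If stage [N] starts at some [r <= t N], the time [t N] is still a candidate in the maximum over
    [r, t N.+1] that gives the reflected path; an early start does no harm. *)
Lemma stage_time_le b delta mu N (t : nat -> R) :
  {within `[0, +oo[, continuous b} -> 0 < mu -> 0 <= t 0%N ->
  (forall i, (i < N)%N -> t i <= t i.+1) ->
  (forall i, (i < N)%N ->
     barrier mu (t i.+1) - delta i * (t i.+1 - t i) <= b (t i.+1) - b (t i)) ->
  (stage_time b delta mu N <= (t N)%:E)%E.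
Proof.
move=> cb mu0 t0; elim: N => [_ _|N IH tS tB] /=; first by rewrite lee_fin.
have {}IH := IH (fun i iN => tS i (leqW iN)) (fun i iN => tB i (leqW iN)).
have := stage_time_ge0 b delta mu N.
move: IH; case: (stage_time _ _ _ _) => [r| |] //; rewrite !lee_fin => rt r0.
have tN := tS N (ltnSn N).
apply: hitting_time_le => //; first exact: le_trans tN.
apply: le_trans (reflected_ge _ _ _ _ (t N) cb r0 _); last by rewrite rt.
by have := tB N (ltnSn N); lra.
Qed.

(** The indices with finite times form an initial segment, so counting up to [k] amounts to the
    finiteness of the [k]-th time. *)
Lemma le_nu_total b a mu k :
  ((k%:R%:E <= nu b a mu `[0%R, +oo[%classic)%E) <->
  stage_time b (stage_drift a) mu k.*2 \is a fin_num.
Proof.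
pose A : set R := `[0, +oo[%classic.
pose f i : \bar R := \d_(fine (xi_plus b a mu i)) A.
have fE i : f i = 1%E.
  rewrite /f diracE mem_set// /A /= in_itv /= andbT fine_ge0// xi_plusE.
  exact: stage_time_ge0.
have f0 i : (0 <= f i)%E by rewrite fE.
have fin_le i j : (i <= j)%N -> xi_plus b a mu j \is a fin_num ->
    xi_plus b a mu i \is a fin_num.
  by rewrite !xi_plusE => ij; apply: stage_time_finW; rewrite leq_double.
rewrite -xi_plusE; split; last first.
  move=> fin; apply: le_trans (nneseries_lim_ge k.+1 _) => //.
  rewrite big_nat_cond (eq_bigr (fun=> 1%E)); last by move=> i _; exact: fE.
  rewrite (eq_bigl (fun i => (1 <= i < k.+1)%N && true)); last first.
    by move=> i; rewrite andbT; apply: andb_idr => /andP[_ ik]; exact: (fin_le _ k).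
  by rewrite -big_nat_cond sumEFin sumr_const_nat subSS subn0.
move=> le_k; apply: contraT => nfin; exfalso; move: le_k; apply/negP.
rewrite -ltNge /nu.
case: k nfin => [//|k] nfin.
rewrite (nneseries_split_cond 1 k); last by move=> i _; exact: f0.
rewrite eseries0 ?adde0; last first.
  by move=> i ki fin; rewrite (fin_le _ _ ki fin) in nfin.
apply: (@le_lt_trans _ _ (\sum_(1 <= i < 1 + k) 1%E)%E).
  by rewrite big_mkcond; apply: lee_sum => i _; case: ifP => _; [rewrite -[X in (X <= _)%E]/(f i) fE|].
by rewrite sumEFin sumr_const_nat add1n subSS subn0 lte_fin ltr_nat.
Qed.

End stages.

(** * Gaussian estimates *)

(** Exponential tilting: multiplying the centred density by exp(theta z - theta^2 sigma^2 / 2)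
    shifts its mean to [theta * sigma ^+ 2], and on [A] this factor is at least the inverse of the
    bound. *)
Lemma normal_prob_chernoff (R : realType) (sigma theta y : R) (A : set R) :
  0 < sigma -> measurable A -> (forall z, A z -> y <= theta * z) ->
  (normal_prob 0 sigma A <= (expR (theta ^+ 2 * sigma ^+ 2 / 2 - y))%:E)%E.
Proof.
move=> s0 mA Ay; have sN0 : sigma != 0 by rewrite gt_eqF.
set c := expR _.
pose m := theta * sigma ^+ 2.
have -> : c%:E = (c%:E * \int[lebesgue_measure]_x (normal_pdf m sigma x)%:E)%E.
  by rewrite integral_normal_pdf mule1.
have c0 : 0 <= c by exact: expR_ge0.
have mpdf m' (D : set R) : measurable_fun D (EFin \o normal_pdf m' sigma).
  apply/measurable_EFinP; apply: (measurable_funS measurableT) => //.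
  exact: measurable_normal_pdf.
have pdf0 m' x : (0 <= (normal_pdf m' sigma x)%:E)%E.
  by rewrite lee_fin normal_pdf_ge0.
rewrite -ge0_integralZl//; [|exact: mpdf].
apply: (@le_trans _ _ (\int[lebesgue_measure]_(x in A)
  (c%:E * (normal_pdf m sigma x)%:E))%E); last first.
  apply: ge0_subset_integral => //.
    by apply: measurable_funeM; exact: mpdf.
  by move=> x _; rewrite mule_ge0.
apply: ge0_le_integral => //.
- exact: mpdf.
- by apply: measurable_funeM; exact: mpdf.
move=> x Ax; rewrite -EFinM lee_fin !normal_pdfE// mulrCA ler_wpM2l//.
  exact: normal_peak_ge0.
rewrite /normal_fun /c -expRD ler_expR subr0.
have := Ay x Ax; rewrite -subr_ge0 => H; rewrite -subr_ge0.
rewrite (_ : _ - _ = theta * x - y)// /m.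
by field.
Qed.

(** Only the mass of [x, x + 1] is kept, where the density is smallest at the right end. *)
Lemma normal_prob_ge (R : realType) (sigma x : R) : 0 < sigma -> 0 <= x ->
  ((normal_peak sigma * expR (- (x + 1) ^+ 2 / (2 * sigma ^+ 2)))%:E <=
    normal_prob 0 sigma `[x, +oo[%classic)%E.
Proof.
move=> s0 x0; have sN0 : sigma != 0 by rewrite gt_eqF.
have pdf0 z : (0 <= (normal_pdf 0 sigma z)%:E)%E.
  by rewrite lee_fin normal_pdf_ge0.
have mpdf (D : set R) : measurable_fun D (EFin \o normal_pdf 0 sigma).
  apply/measurable_EFinP; apply: (measurable_funS measurableT) => //.
  exact: measurable_normal_pdf.
set c := _ * _.
have c0 : 0 <= c by rewrite mulr_ge0 ?expR_ge0 ?normal_peak_ge0.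
apply: (@le_trans _ _ (\int[lebesgue_measure]_(z in `[x, (x + 1)%R]) c%:E)%E).
  rewrite integral_cst//= lebesgue_measure_itv/= lte_fin ltrDl ltr01.
  by rewrite -EFinB addrAC subrr add0r mule1.
apply: (@le_trans _ _
    (\int[lebesgue_measure]_(z in `[x, (x + 1)%R]) (normal_pdf 0 sigma z)%:E)%E).
  apply: ge0_le_integral => //; first exact: mpdf.
  move=> z /=; rewrite in_itv /= => /andP[xz zx].
  rewrite lee_fin normal_pdfE// ler_wpM2l ?normal_peak_ge0//.
  rewrite /normal_fun ler_expR subr0 mulr_natl !mulNr lerN2.
  rewrite ler_wpM2r ?invr_ge0 ?mulrn_wge0 ?sqr_ge0//.
  by rewrite ler_sqr// nnegrE; lra.
apply: ge0_subset_integral => //; first exact: mpdf.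
by move=> z /=; rewrite !in_itv /= => /andP[->].
Qed.

Lemma geometric_union_bound (R : realType) (d : measure_display)
    (T : measurableType d) (P : probability T R) (F : nat -> set T) (C r : R) :
  0 <= C -> 0 <= r < 1 -> (forall n, measurable (F n)) ->
  (forall n, P (F n) <= (C * r ^+ n)%:E)%E ->
  (P (\bigcup_n F n) <= (C / (1 - r))%:E)%E.
Proof.
move=> C0 /andP[r0 r1] mF PF.
apply: (le_trans (generalized_Boole_inequality P mF _)).
  exact: bigcup_measurable.
apply: (@le_trans _ _ (\sum_(0 <= n <oo) (C * r ^+ n)%:E)%E).
  by apply: lee_nneseries => // n _; exact: PF.
apply: lime_le.
  by apply: is_cvg_nneseries => n _ _; rewrite lee_fin mulr_ge0// exprn_ge0.
apply: nearW => n; rewrite sumEFin lee_fin.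
have -> : \sum_(0 <= i < n) C * r ^+ i = C * (1 - r ^+ n) / (1 - r).
  have r1' : 1 - r != 0 by rewrite subr_eq0 gt_eqF.
  apply: (mulIf r1'); rewrite mulfVK//.
  elim: n => [|n IH]; first by rewrite big_geq// expr0; ring.
  by rewrite big_nat_recr//= mulrDl IH exprS; ring.
apply: ler_wpM2r; first by rewrite invr_ge0 subr_ge0 ltW.
by rewrite ler_piMr// gerBl exprn_ge0.
Qed.

(** The dyadic approximations [v n] of [t] from below either stay or advance by one step of the next
    level; continuity carries the bound over to [t]. *)
Lemma dyadic_chaining (R : realType) (b : R -> R) (s x : R) : 0 <= s -> 0 <= x ->
  {within `[0, +oo[, continuous b} ->
  (forall n i, (i < 2 ^ n.+1)%N ->
    `|b (s + i.+1%:R / 2 ^+ n.+1) - b (s + i%:R / 2 ^+ n.+1)|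
      <= (3 / 4) ^+ n.+1 / 3 * x) ->
  forall t, s <= t < s + 1 -> `|b t - b s| <= x.
Proof.
move=> s0 x0 /within_continuousP cb H t /andP[st ts].
pose k n := Num.truncn ((t - s) * 2 ^+ n).
have p2 n : 0 < 2 ^+ n :> R by rewrite exprn_gt0.
have kP n : (k n)%:R <= (t - s) * 2 ^+ n < (k n).+1%:R.
  by apply: truncn_itv; rewrite mulr_ge0 ?subr_ge0// ltW.
pose v n := s + (k n)%:R / 2 ^+ n.
have vt n : v n <= t.
  by have /andP[+ _] := kP n; rewrite -ler_pdivrMr// /v; lra.
have tv n : t < v n + (2 ^+ n)^-1.
  have /andP[_] := kP n.
  by rewrite -ltr_pdivlMr// -natr1 mulrDl mul1r /v; lra.
have kS n : k n.+1 = (k n).*2 \/ k n.+1 = (k n).*2.+1.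
  have /andP[a1 a2] := kP n; have /andP[] := kP n.+1.
  rewrite exprS => a3 a4.
  have l1 : ((k n).*2 < (k n.+1).+1)%N.
    by rewrite -(ltr_nat R) -muln2 natrM; lra.
  have l2 : (k n.+1 < (k n).*2.+2)%N.
    by rewrite -(ltr_nat R) -[(k n).*2.+2]/((k n).+1.*2) -muln2 natrM; lra.
  by have [] := ltnP (k n.+1) (k n).*2.+1 => ?; [left|right]; lia.
have k2 n : (k n < 2 ^ n)%N.
  have /andP[a1 _] := kP n.
  rewrite -(ltr_nat R) natrX; apply: (le_lt_trans a1).
  by rewrite gtr_pMl//; lra.
(* The shares (3/4)^(m+1) / 3 for m < n telescope to 1 - (3/4)^n. *)
have bv n : `|b (v n) - b s| <= (1 - (3 / 4) ^+ n) * x.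
  elim: n => [|n IH].
    have k0 : k 0%N = 0%N by have := k2 0%N; rewrite expn0; case: (k 0%N).
    by rewrite /v k0 mul0r addr0 subrr normr0 expr0 subrr mul0r.
  have pn : 0 < (3 / 4) ^+ n :> R by rewrite exprn_gt0.
  have [kE|kE] := kS n.
    have -> : v n.+1 = v n.
      rewrite /v kE exprS -muln2 natrM; congr (_ + _); field.
      by rewrite gt_eqF.
    apply: (le_trans IH); rewrite exprS; nra.
  have -> : b (v n.+1) - b s = (b (v n.+1) - b (v n)) + (b (v n) - b s) by ring.
  apply: (le_trans (ler_normD _ _)).
  have vE : v n = s + (k n).*2%:R / 2 ^+ n.+1.
    rewrite /v exprS -muln2 natrM; congr (_ + _); field.
    by rewrite gt_eqF.
  have := H n (k n).*2 ltac:(by rewrite expnS mul2n ltn_double).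
  rewrite -vE -kE -/(v n.+1) => H'.
  apply: (le_trans (lerD H' IH)); rewrite exprS; nra.
apply/ler_addgt0Pr => e e0.
have [|r r0 rP] := cb t _ e e0; first by rewrite /= in_itv /= andbT (le_trans s0).
pose n := (Num.truncn r^-1).+1.
have nr : (2 ^+ n)^-1 < r.
  rewrite invf_plt ?posrE//; apply: (@lt_le_trans _ _ n%:R).
    by have /andP[] := truncn_itv (ltW (ltac:(by rewrite invr_gt0) : 0 < r^-1)).
  by rewrite -natrX ler_nat ltnW// ltn_expl.
have vs : 0 <= v n by rewrite addr_ge0// divr_ge0// ltW.
have /rP : v n \in `[0, +oo[ by rewrite in_itv /= andbT.
rewrite ger0_norm ?subr_ge0// => /(_ ltac:(have := tv n; lra)) bt.
have -> : b t - b s = (b (v n) - b s) + (b t - b (v n)) by ring.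
apply: (le_trans (ler_normD _ _)); apply: lerD; last exact: ltW.
apply: (le_trans (bv n)).
by rewrite ler_piMl// gerBl exprn_ge0.
Qed.

Lemma measurable_norm_gt (R : realType) (y : R) :
  measurable ([set z | y < `|z|] : set R).
Proof.
rewrite (_ : [set z | _] = `]-oo, (- y)[ `|` `]y, +oo[); first exact: measurableU.
apply/seteqP; split => z /=; rewrite !in_itv /= andbT ltr_normr.
  by case/orP => ?; [right|left; lra].
by case => ?; apply/orP; [right; lra|left].
Qed.

(** * Increments and oscillations of Brownian motion *)

Section brownian.
Context {R : realType} {d : measure_display} {T : measurableType d}.
Context {P : probability T R} {B : R -> {RV P >-> R}} (hB : standard_BM B).

Lemma measurable_increment (s t : R) (A : set R) : measurable A ->
  measurable ((B t \- B s)%R @^-1` A).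
Proof.
move=> mA; rewrite -[X in measurable X]setTI.
apply: measurable_funB => //; exact: measurable_funPT.
Qed.

Lemma BM_chernoff (s t theta y : R) (A : set R) : 0 <= s -> s <= t ->
  measurable A -> (forall z, A z -> y <= theta * z) ->
  (P ((B t \- B s)%R @^-1` A) <= (expR (theta ^+ 2 * (t - s) / 2 - y))%:E)%E.
Proof.
move=> s0; rewrite le_eqVlt => /predU1P[<-|st] mA Ay; last first.
  rewrite (BM_gaussian hB)//.
  have sq0 : 0 < Num.sqrt (t - s) by rewrite sqrtr_gt0 subr_gt0.
  have := normal_prob_chernoff _ _ theta y A sq0 mA Ay.
  by rewrite sqr_sqrtr// subr_ge0 ltW.
(* An interval of length 0 is outside the Gaussian clause. If [A] contains 0, then [y <= 0] and the
   bound is at least 1; otherwise the event is empty. *)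
have -> : (B s \- B s) @^-1` A = [set _ | A 0].
  by apply/seteqP; split=> w /=; rewrite subrr.
have [A0|nA0] := pselect (A 0); last first.
  rewrite (_ : [set _ | _] = set0) ?measure0 ?lee_fin ?expR_ge0//.
  by apply/seteqP; split=> // w.
have := Ay _ A0; rewrite mulr0 => y0.
rewrite (_ : [set _ | _] = setT); last by apply/seteqP; split=> // w.
rewrite probability_setT subrr mulr0 mul0r sub0r lee_fin.
by rewrite -expR0 ler_expR; lra.
Qed.

(** Each of the two tails is bounded with its optimal tilt, y / (t - s) up to sign. *)
Lemma BM_increment_gt (s t y : R) : 0 <= s -> s < t -> 0 <= y ->
  (P ((B t \- B s)%R @^-1` [set z | (y < `|z|)%R]) <=
    (2 * expR (- (y ^+ 2 / (2 * (t - s)))))%:E)%E.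
Proof.
move=> s0 st y0.
have ts0 : 0 < t - s by rewrite subr_gt0.
have mside th :
    measurable ([set z | y ^+ 2 / (t - s) <= th / (t - s) * z] : set R).
  rewrite -[X in measurable X]setTI.
  apply: (measurable_fun_le (f := cst _) (g := fun z => th / (t - s) * z)) => //.
  exact: measurable_funM.
have side th : th = y \/ th = - y ->
    (P ((B t \- B s)%R @^-1` [set z | (y ^+ 2 / (t - s) <= th / (t - s) * z)%R]) <=
     (expR (- (y ^+ 2 / (2 * (t - s)))))%:E)%E.
  move=> thy.
  have -> : - (y ^+ 2 / (2 * (t - s))) =
      (th / (t - s)) ^+ 2 * (t - s) / 2 - y ^+ 2 / (t - s).
    have -> : (th / (t - s)) ^+ 2 = y ^+ 2 / (t - s) ^+ 2.
      by case: thy => ->; rewrite expr_div_n ?sqrrN.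
    by field; rewrite gt_eqF.
  apply: BM_chernoff => //; exact: ltW.
rewrite mulr_natl mulr2n EFinD.
apply: le_trans (leeD (side y (or_introl erefl)) (side (- y) (or_intror erefl))).
have mE th := measurable_increment s t _ (mside th).
apply: le_trans (measureU2 P (mE y) (mE (- y))).
apply: le_measure; rewrite ?inE.
- by apply: measurable_increment; exact: measurable_norm_gt.
- by apply: measurableU; exact: mE.
move=> w /=; set z := B t w - B s w; rewrite ltr_normr => yz.
have c0 : 0 <= y / (t - s) by rewrite divr_ge0// ltW.
have -> : y ^+ 2 / (t - s) = y / (t - s) * y by ring.
have -> : - y / (t - s) * z = y / (t - s) * - z by ring.
by case/orP: yz => yz; [left|right]; apply: ler_wpM2l => //; exact: ltW.
Qed.

(* The dyadic increments at level [n] are allowed the share [(3 / 4) ^+ n / 3]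
   of [x]; these shares add up to 1, and since [(3 / 4) ^+ 2 * 2 > 1] the
   Gaussian tails beat the number of increments. *)
Lemma BM_oscillation (s x : R) : 0 <= s -> 17 <= x ->
  exists2 N : set T, measurable N & (P N <= (2 * expR (- (x ^+ 2 / 18)))%:E)%E /\
    forall w, ~ N w -> {within `[0, +oo[, continuous (fun t => B t w)} ->
      forall t, s <= t < s + 1 -> `|B t w - B s w| <= x.
Proof.
move=> s0 x17; have x0 : 0 <= x by lra.
pose v n i : R := s + i%:R / 2 ^+ n.+1.
pose y n : R := (3 / 4) ^+ n.+1 / 3 * x.
pose E n i := ((B (v n i.+1) \- B (v n i))%R @^-1` [set z | y n < `|z|]).
pose F n := \big[setU/set0]_(i < 2 ^ n.+1) E n i.
have y0 n : 0 <= y n by rewrite mulr_ge0// divr_ge0// exprn_ge0.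
have mE n i : measurable (E n i).
  by apply: measurable_increment; exact: measurable_norm_gt.
have mF n : measurable (F n) by apply: bigsetU_measurable.
exists (\bigcup_n F n); first exact: bigcup_measurable.
split; last first.
  move=> w nF cb t st.
  apply: (dyadic_chaining _ (fun t => B t w) s x s0 x0 cb _ t st) => n i i2.
  rewrite leNgt; apply/negP => yi; apply: nF; exists n => //.
  by rewrite /F -(bigcup_mkord _ (E n)); exists i.
have -> : 2 * expR (- (x ^+ 2 / 18)) = expR (- (x ^+ 2 / 18)) / (1 - 2^-1).
  by field.
apply: geometric_union_bound => //; first by lra.
move=> n; apply: (le_trans (Boole_inequality P _)) => //.
apply: (@le_trans _ _ (\sum_(i < 2 ^ n.+1)
    (2 * (expR (- (x ^+ 2 / 18)) / 4 ^+ n.+1))%:E)%E); last first.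
  rewrite sumEFin lee_fin sumr_const card_ord -[leLHS]mulr_natr natrX.
  have p2 : 2 ^+ n != 0 :> R by rewrite expf_neq0.
  have -> : 4 ^+ n.+1 = (2 ^+ n.+1) ^+ 2 :> R by rewrite exprAC; congr (_ ^+ _); ring.
  rewrite le_eqVlt; apply/orP; left; apply/eqP; rewrite exprVn !exprS.
  by field.
apply: lee_sum => i _.
have vv : v n i.+1 - v n i = (2 ^+ n.+1)^-1.
  by rewrite /v -natr1; ring.
have v0 : 0 <= v n i by rewrite addr_ge0// divr_ge0// exprn_ge0.
have vlt : v n i < v n i.+1 by rewrite -subr_gt0 vv invr_gt0 exprn_gt0.
apply: (le_trans (BM_increment_gt _ _ _ v0 vlt (y0 n))).
rewrite lee_fin ler_wpM2l// vv.
(* The exponent at level [n] is (9/8)^(n+1) x^2 / 18. Bernoulli's inequality splits off x^2 / 144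
   per level, which exceeds 2 because [x >= 17]; this yields a factor 1/4 per level against the
   doubling number of increments. *)
have e4 : expR (- (x ^+ 2 / 144)) <= 4^-1.
  rewrite expRN lef_pV2 ?posrE ?expR_gt0//.
  apply: (@le_trans _ _ (expR (1 + 1))).
    rewrite expRD; have := @expR_ge1Dx R 1; nra.
  by rewrite ler_expR; nra.
apply: (@le_trans _ _ (expR (- (x ^+ 2 / 18)) * expR (- (x ^+ 2 / 144)) ^+ n.+1)).
  rewrite -expRM_natl -expRD ler_expR.
  have bern : 1 + n.+1%:R / 8 <= (9 / 8) ^+ n.+1 :> R.
    elim: n.+1 => [|m IH]; first by rewrite expr0 mul0r addr0.
    by rewrite exprS -natr1; have := ler0n R m; nra.
  have -> : y n ^+ 2 / (2 * (2 ^+ n.+1)^-1) = (9 / 8) ^+ n.+1 * (x ^+ 2 / 18).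
    have -> : 9 / 8 = (3 / 4) ^+ 2 * 2 :> R by field.
    rewrite /y [X in _ = X * _]exprMn (exprAC _ 2); field.
    by rewrite expf_neq0.
  have := sqr_ge0 x; nra.
by rewrite -exprVn ler_wpM2l ?expR_ge0// lerXn2r ?nnegrE ?expR_ge0.
Qed.

End brownian.

(** * Upper bound *)

Lemma prod_double (R : realDomainType) (F : nat -> \bar R) (N : nat) :
  (\prod_(j < N.*2) F j = \prod_(i < N) (F i.*2 * F i.*2.+1))%E.
Proof.
elim: N => [|N IH]; first by rewrite !big_ord0.
by rewrite doubleS !big_ord_recr/= IH muleA.
Qed.

Lemma prode_le (R : realDomainType) (F : nat -> \bar R) (f : nat -> R) (N : nat) :
  (forall i, (i < N)%N -> 0%:E <= F i <= (f i)%:E)%E ->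
  (\prod_(i < N) F i <= (\prod_(i < N) f i)%:E)%E.
Proof.
elim: N => [_|N IH H]; first by rewrite !big_ord0.
rewrite !big_ord_recr/= EFinM.
have /andP[F0 Ff] := H N (ltnSn N).
apply: lee_pmul => //.
  by apply: prode_ge0 => i _; have /andP[] := H i (ltnW (ltn_ord i)).
by apply: IH => i iN; apply: H; exact: ltnW.
Qed.

Lemma le_prode (R : realDomainType) (F : nat -> \bar R) (f : nat -> R) (N : nat) :
  (forall i, (i < N)%N -> 0 <= f i /\ ((f i)%:E <= F i)%E) ->
  ((\prod_(i < N) f i)%:E <= \prod_(i < N) F i)%E.
Proof.
elim: N => [_|N IH H]; first by rewrite !big_ord0.
rewrite !big_ord_recr/= EFinM.
have [f0 Ff] := H N (ltnSn N).
apply: lee_pmul => //; last by apply: IH => i iN; apply: H; exact: ltnW.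
by rewrite lee_fin prodr_ge0// => i _; have [] := H i (ltnW (ltn_ord i)).
Qed.

(** Half of the exponent absorbs one factor, the other half the remaining ones. *)
Lemma poly_le_expR (R : realType) (n : nat) (c : R) : 0 < c ->
  exists2 K, 0 < K & forall m : nat, m.+1%:R ^+ n <= K * expR (c * m%:R).
Proof.
elim: n c => [|n IH] c c0.
  by exists 1 => // m; rewrite expr0 mul1r -expR0 ler_expR mulr_ge0// ltW.
have [K K0 HK] := IH (c / 2) ltac:(by rewrite divr_gt0).
exists (K * (1 + 2 / c)); first by rewrite mulr_gt0// addr_gt0// divr_gt0.
move=> m; rewrite exprSr.
have -> : c * m%:R = c / 2 * m%:R + c / 2 * m%:R by field.
rewrite expRD mulrACA; apply: ler_pM; rewrite ?exprn_ge0 ?HK//.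
apply: (@le_trans _ _ ((1 + 2 / c) * (1 + c / 2 * m%:R))); last first.
  by rewrite ler_wpM2l ?expR_ge1Dx// addr_ge0// divr_ge0// ltW.
have -> : (1 + 2 / c) * (1 + c / 2 * m%:R) = m.+1%:R + (2 / c + c / 2 * m%:R).
  by rewrite -natr1; field; rewrite gt_eqF.
by rewrite lerDl addr_ge0// ?divr_ge0// ?mulr_ge0// ?divr_ge0// ltW.
Qed.

Lemma union_bound_seq (R : realType) (d : measure_display)
    (T : measurableType d) (P : probability T R) (I : Type) (s : seq I)
    (F : I -> set T) (C : R) : (forall i, measurable (F i)) ->
  (forall i, P (F i) <= C%:E)%E ->
  measurable (\big[setU/set0]_(i <- s) F i) /\
  (P (\big[setU/set0]_(i <- s) F i) <= ((size s)%:R * C)%:E)%E.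
Proof.
move=> mF PF; elim: s => [|i s [mS IH]].
  by rewrite big_nil measure0 mul0r.
rewrite big_cons; split; first exact: measurableU.
apply: (le_trans (measureU2 P (mF i) mS)).
by rewrite /= -natr1 mulrDl mul1r addrC EFinD leeD.
Qed.

Section tail_sums.
Context {R : realType}.
Implicit Types (delta theta : nat -> R).

(** The multiplier V i of the duality equations. *)
Definition tail_sum theta (N i : nat) : R := \sum_(i <= j < N) theta j.

Lemma tail_sum_ge0 theta N i : (forall j, (j < N)%N -> 0 < theta j) ->
  0 <= tail_sum theta N i.
Proof.
move=> t0; rewrite /tail_sum big_nat_cond; apply: sumr_ge0 => j.
by rewrite andbT => /andP[_ jN]; rewrite ltW// t0.
Qed.

Lemma tail_sum_recl theta N i : (i < N)%N ->
  tail_sum theta N i = theta i + tail_sum theta N i.+1.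
Proof. by move=> iN; rewrite /tail_sum big_ltn. Qed.

(* Summation by parts: the weight [theta i] of the barrier's slope [q] at the
   time [p i.+1] is spread over the time intervals that precede it, where it
   adds up to [tail_sum]. *)
Lemma sum_by_parts_ge theta delta (N : nat) (q kappa c : R) (p n : nat -> R) :
  (forall i, (i < N)%N -> kappa <= q * tail_sum theta N i) ->
  (forall i, (i < N)%N -> kappa <=
     q * tail_sum theta N i - theta i * delta i - c * theta i ^+ 2) ->
  p 0%N = 0 -> (forall i, (i < N)%N -> p i <= n i <= p i.+1) ->
  kappa * p N <= \sum_(i < N) (theta i * (q * p i.+1) -
    (theta i * delta i + c * theta i ^+ 2) * (p i.+1 - n i)).
Proof.
move=> k1 k2 p0 pn; rewrite -(big_mkord xpredT (fun i => theta i * (q * p i.+1) -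
    (theta i * delta i + c * theta i ^+ 2) * (p i.+1 - n i))).
(* Backward induction on the stages. The extra term is what the slope [q] before time [p j]
   contributes to all barriers from stage [j] on. *)
suff H m : forall j, (j + m)%N = N ->
    q * tail_sum theta N j * p j + kappa * (p N - p j) <=
    \sum_(j <= i < N) (theta i * (q * p i.+1) -
    (theta i * delta i + c * theta i ^+ 2) * (p i.+1 - n i)).
  by have := H N 0%N (add0n N); rewrite p0 mulr0 subr0 add0r.
elim: m => [|m IH] j; first by rewrite addn0 => ->; rewrite /tail_sum !big_geq//; lra.
rewrite addnS -addSn => jm.
have jN : (j < N)%N by rewrite -jm ltnS leq_addr.
rewrite big_ltn//; have := IH _ jm.
have := k1 j jN; have := k2 j jN; rewrite tail_sum_recl//.
move: (pn j jN) => /andP[]; set V := tail_sum _ _ _.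
set S := \sum_(_ <= _ < _) _; set g := theta j * delta j.
move=> h1 h2 h3 h4 h5.
(* The second hypothesis pays for [n j, p j.+1], where the increment is taken, the first one for the
   idle time [p j, n j]. *)
have : kappa * (p j.+1 - n j) <=
    (q * (theta j + V) - g - c * theta j ^+ 2) * (p j.+1 - n j).
  by rewrite ler_wpM2r// subr_ge0.
have : kappa * (n j - p j) <= q * (theta j + V) * (n j - p j).
  by rewrite ler_wpM2r// subr_ge0.
by lra.
Qed.
End tail_sums.

Lemma finite_positive_lbound (R : realType) (theta : nat -> R) (N : nat) :
  (forall i, (i < N)%N -> 0 < theta i) ->
  exists2 c, 0 < c & forall i, (i < N)%N -> c <= theta i.
Proof.
elim: N => [|N IH] t0; first by exists 1.
have [c c0 cP] := IH (fun i iN => t0 i (ltnW iN)).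
exists (Num.min c (theta N)); first by rewrite lt_min c0 t0.
move=> i; rewrite ltnS leq_eqVlt => /predU1P[->|/cP]; rewrite ge_min ?lexx ?orbT//.
by move=> ->.
Qed.

Section upper_bound.
Context {R : realType} {d : measure_display} {T : measurableType d}.
Context {P : probability T R} {B : R -> {RV P >-> R}} (hB : standard_BM B).
Implicit Types (delta theta : nat -> R).

(** Interleaving [p] and [n] gives consecutive intervals; the whole line is imposed on the
    increments over [p i, n i]. *)
Lemma BM_independent_gaps (N : nat) (p n : nat -> R) (A : nat -> set R) :
  0 <= p 0%N -> (forall i, (i < N)%N -> p i <= n i <= p i.+1) ->
  (forall i, measurable (A i)) ->
  P (\bigcap_(i in `I_N) ((B (p i.+1) \- B (n i)) @^-1` A i)) =
  (\prod_(i < N) P ((B (p i.+1) \- B (n i))%R @^-1` A i))%E.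
Proof.
move=> p0 pn mA.
pose t j := if odd j then n j./2 else p j./2.
pose A' j := if odd j then A j./2 else setT.
have tS j : (j < N.*2)%N -> t j <= t j.+1.
  rewrite -{1}(odd_double_half j) /t /= => jN.
  have jN' : (j./2 < N)%N by lia.
  rewrite uphalf_half; have /andP[] := pn _ jN'.
  by case: (odd j) => //=; rewrite add1n.
have := @BM_independent _ _ _ _ _ hB N.*2 t A' p0 tS.
rewrite (prod_double _ (fun j => P ((B (t j.+1) \- B (t j)) @^-1` A' j))) => H.
have te i : t i.*2 = p i by rewrite /t odd_double doubleK.
have to i : t i.*2.+1 = n i by rewrite /t /= odd_double uphalf_double.
have ts i : t i.*2.+2 = p i.+1 by rewrite -doubleS te.
rewrite (_ : \bigcap_(i in `I_N) _ =
  \bigcap_(i in `I_(N.*2)) ((B (t i.+1) \- B (t i)) @^-1` A' i)).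
  rewrite H; last by move=> j; rewrite /A'; case: ifP.
  apply: eq_bigr => i _; rewrite ts to te /A' /= odd_double /= uphalf_double.
  by rewrite preimage_setT probability_setT mul1e.
apply/seteqP; split => w /= Hw j /= jN.
  rewrite /A'; case: ifPn => // oj.
  have jE : j = (j./2).*2.+1 by rewrite -{1}(odd_double_half j) oj.
  have -> : t j.+1 = p j./2.+1 by rewrite {1}jE ts.
  have -> : t j = n j./2 by rewrite {1}jE to.
  by apply: Hw => /=; lia.
have := Hw j.*2.+1 ltac:(by rewrite /= ltn_Sdouble).
by rewrite ts to /A' /= odd_double /= uphalf_double.
Qed.

Lemma BM_box_chernoff (N : nat) (p n x theta : nat -> R) :
  0 <= p 0%N -> (forall i, (i < N)%N -> p i <= n i <= p i.+1) ->
  (forall i, (i < N)%N -> 0 <= theta i) ->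
  (P (\bigcap_(i in `I_N) ((B (p i.+1) \- B (n i))%R @^-1` `[x i, +oo[)) <=
   (expR (\sum_(i < N) (theta i ^+ 2 * (p i.+1 - n i) / 2 - theta i * x i)))%:E)%E.
Proof.
move=> p0 pn th0; rewrite BM_independent_gaps//.
have n0 i : (i < N)%N -> 0 <= n i.
  have : (i < N)%N -> 0 <= p i.
    elim: i => [//|i IH] iN; have /andP[a1 a2] := pn i (ltnW iN).
    exact: le_trans (IH (ltnW iN)) (le_trans a1 a2).
  by move=> + iN => /(_ iN) pi; have /andP[+ _] := pn i iN; exact: le_trans.
rewrite expR_sum; apply: (prode_le _ (fun i => P ((B (p i.+1) \- B (n i)) @^-1` `[x i, +oo[))
  (fun i => expR (theta i ^+ 2 * (p i.+1 - n i) / 2 - theta i * x i))) => i iN.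
rewrite measure_ge0/=; apply: (BM_chernoff hB) => //; first exact: n0.
- by have /andP[] := pn i iN.
- by move=> z /=; rewrite in_itv /= andbT; exact/ler_wpM2l/th0.
Qed.

(* There are at most [(m + 1) ^ (2 N + 1)] grid sequences ending at [m], which
   the factor [expR (- (kappa * m))] compensates. *)
Lemma BM_grid_bound (N : nat) (kappa : R) : 0 < kappa ->
  exists2 K, 0 < K & forall theta (x : R -> R -> nat -> R) (A : R),
    (forall i, (i < N)%N -> 0 <= theta i) ->
    (forall p n : nat -> R, p 0%N = 0 ->
       (forall i, (i < N)%N -> p i <= n i <= p i.+1) ->
       \sum_(i < N) (theta i ^+ 2 * (p i.+1 - n i) / 2 -
                     theta i * x (p i.+1) (n i) i) <= A - kappa * p N) ->
    exists2 E : set T, measurable E & (P E <= (K * expR A)%:E)%E /\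
      forall w (p n : nat -> nat), p 0%N = 0%N ->
        (forall i, (i < N)%N -> (p i <= n i <= p i.+1)%N) ->
        (forall i, (i < N)%N ->
          x (p i.+1)%:R (n i)%:R i <= B (p i.+1)%:R w - B (n i)%:R w) ->
        E w.
Proof.
move=> k0.
(* Half of [kappa] absorbs the number of grid sequences, the other half makes the sum over their
   last time geometric. *)
have [K K0 HK] := poly_le_expR _ (N.*2).+1 (kappa / 2) ltac:(by rewrite divr_gt0).
have r1 : expR (- (kappa / 2)) < 1.
  by rewrite -expR0 ltr_expR oppr_lt0 divr_gt0.
exists (K / (1 - expR (- (kappa / 2)))); first by rewrite divr_gt0// subr_gt0.
move=> theta x A th0 HA.
(* Grid sequences ending at [M] are coded by finite functions, with [p] at even and [n] at odd
   indices; codes of no valid sequence get the empty event. *)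
pose G M := {ffun 'I_(N.*2).+1 -> 'I_M.+1}.
pose pt M (g : G M) i : R := (g (inord i.*2))%:R.
pose nt M (g : G M) i : R := (g (inord i.*2.+1))%:R.
pose valid M (g : G M) := [/\ pt M g 0%N = 0, pt M g N = M%:R &
  forall i, (i < N)%N -> pt M g i <= nt M g i <= pt M g i.+1].
pose F M (g : G M) := if `[< valid M g >] then
  \bigcap_(i in `I_N) ((B (pt M g i.+1) \- B (nt M g i))%R @^-1`
    `[x (pt M g i.+1) (nt M g i) i, +oo[) else set0.
have mF M g : measurable (F M g).
  rewrite /F; case: ifP => // _.
  apply: fin_bigcap_measurable; first exact: finite_II.
  by move=> i _; exact: measurable_increment.
have PF M g : (P (F M g) <= (expR (A - kappa * M%:R))%:E)%E.
  rewrite /F; case: asboolP => [[p0 pN pn]|_]; last by rewrite measure0 lee_fin expR_ge0.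
  apply: (le_trans (BM_box_chernoff N (pt M g) (nt M g)
    (fun i => x (pt M g i.+1) (nt M g i) i) theta _ pn th0)); first by rewrite p0.
  by rewrite lee_fin ler_expR -pN; exact: HA.
pose U M := \big[setU/set0]_(g <- index_enum (G M)) F M g.
have [mU PU] : (forall M, measurable (U M)) /\ (forall M,
    P (U M) <= ((size (index_enum (G M)))%:R * expR (A - kappa * M%:R))%:E)%E.
  by split=> M; have [] := union_bound_seq _ _ _ P _ (index_enum (G M)) _ _ (mF M) (PF M).
exists (\bigcup_M U M); first exact: bigcup_measurable.
split.
  rewrite mulrAC; apply: geometric_union_bound => //.
    by rewrite mulr_ge0 ?expR_ge0// ltW.
    by rewrite expR_ge0 r1.
  move=> M; apply: (le_trans (PU M)); rewrite lee_fin.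
  have -> : size (index_enum (G M)) = (M.+1 ^ (N.*2).+1)%N.
    transitivity #|G M|; first by rewrite cardT enumT.
    by rewrite card_ffun !card_ord.
  rewrite natrX -expRM_natl.
  apply: (@le_trans _ _ (K * expR (kappa / 2 * M%:R) * expR (A - kappa * M%:R))).
    by rewrite ler_wpM2r ?expR_ge0.
  rewrite -!mulrA ler_wpM2l ?(ltW K0)// -!expRD ler_expR; lra.
move=> w p n p0 pn Hw; exists (p N) => //.
pose g : G (p N) := [ffun j : 'I_(N.*2).+1 =>
  inord (if odd j then n j./2 else p j./2)].
have pS i j : (i <= j)%N -> (j <= N)%N -> (p i <= p j)%N.
  elim: j => [|j IH]; first by rewrite leqn0 => /eqP ->.
  rewrite leq_eqVlt => /predU1P[->//|ij] jN.
  have /andP[a1 a2] := pn j jN.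
  exact: leq_trans (IH ij (ltnW jN)) (leq_trans a1 a2).
have ptE i : (i <= N)%N -> pt _ g i = (p i)%:R.
  move=> iN; have iE : (inord i.*2 : 'I_(N.*2).+1) = i.*2 :> nat.
    by rewrite inordK// ltnS leq_double.
  rewrite /pt ffunE iE.
  by rewrite odd_double doubleK inordK// ltnS pS.
have ntE i : (i < N)%N -> nt _ g i = (n i)%:R.
  move=> iN; have iE : (inord i.*2.+1 : 'I_(N.*2).+1) = i.*2.+1 :> nat.
    by rewrite inordK// ltnS ltn_double.
  rewrite /nt ffunE iE /= odd_double uphalf_double inordK// ltnS.
  by have /andP[_ h] := pn i iN; apply: (leq_trans h); exact: pS.
rewrite /U -bigcup_seq; exists g; first exact: mem_index_enum.
rewrite /F asboolT; last first.
  split; rewrite ?ptE// ?p0// => i iN.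
  by rewrite ptE ?ntE ?ptE ?ler_nat ?pn// ltnW.
by move=> i iN /=; rewrite in_itv /= andbT ptE ?ntE//; exact: Hw.
Qed.

(** The Gaussian tail is quadratic in [mu + n], so it beats any linear rate [A] and is summable over
    the unit intervals. *)
Lemma BM_oscillation_grid (eta A : R) : 0 < eta -> 0 < A ->
  exists mu0, forall mu, mu0 <= mu ->
    exists2 E : set T, measurable E &
      (P E <= (2 * expR (- (A * mu)) / (1 - expR (-1)))%:E)%E /\
      forall w, ~ E w -> {within `[0, +oo[, continuous (fun t => B t w)} ->
        forall (n : nat) (t : R), n%:R <= t < n%:R + 1 ->
          `|B t w - B n%:R w| <= eta * (mu + n%:R).
Proof.
move=> eta0 A0.
pose A1 := Num.max A 1.
(* [17 / eta] meets the threshold of [BM_oscillation]; the last term makes the exponent at least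
   [A1 * (mu + n)], hence at least [A * mu + n]. *)
exists (Num.max 1 (Num.max (17 / eta) (18 * A1 / eta ^+ 2))) => mu.
rewrite !ge_max => /andP[mu1 /andP[mu17 muA]].
have nP (n : nat) : exists N : set T, [/\ measurable N,
    (P N <= (2 * expR (- ((eta * (mu + n%:R)) ^+ 2 / 18)))%:E)%E &
    forall w, ~ N w -> {within `[0, +oo[, continuous (fun t => B t w)} ->
      forall t, n%:R <= t < n%:R + 1 -> `|B t w - B n%:R w| <= eta * (mu + n%:R)].
  have [|N mN [PN HN]] := BM_oscillation hB n%:R (eta * (mu + n%:R)) (ler0n _ _).
    rewrite [leRHS]mulrC -ler_pdivrMr//; apply: (le_trans mu17).
    by rewrite lerDl.
  by exists N.
have [N HN] := choice nP.
exists (\bigcup_n N n); first by apply: bigcup_measurable => n _; have [] := HN n.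
split; last first.
  move=> w nN cb n; have [_ _] := HN n; apply=> // Nn; apply: nN.
  by exists n.
apply: geometric_union_bound => //.
- by rewrite expR_ge0 expR_lt1 ltrN10.
- by move=> n; have [] := HN n.
move=> n; have [_ PN _] := HN n; apply: (le_trans PN).
rewrite lee_fin -mulrA ler_wpM2l// -expRM_natl -expRD ler_expR.
have n0 := ler0n R n.
have e2 : 0 < eta ^+ 2 by rewrite exprn_gt0.
have h1 : 18 * A1 <= eta ^+ 2 * mu by rewrite [leRHS]mulrC -ler_pdivrMr.
have [A1A A11] : A <= A1 /\ 1 <= A1 by rewrite /A1; split; rewrite le_max lexx ?orbT.
have h2 : A1 * (mu + n%:R) <= (eta * (mu + n%:R)) ^+ 2 / 18.
  rewrite ler_pdivlMr// exprMn [X in _ <= _ * X]expr2.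
  have : 18 * A1 * (mu + n%:R) <= eta ^+ 2 * mu * (mu + n%:R).
    by rewrite ler_wpM2r//; lra.
  have : 0 <= eta ^+ 2 * n%:R * (mu + n%:R).
    by rewrite !mulr_ge0//; lra.
  by lra.
nra.
Qed.

(* Chernoff's bound with the tilts [(1 - eps) * theta i]; the factor [1 - eps]
   makes the bounds summable over all grid sequences. *)
Theorem stage_time_upper (N : nat) delta theta (eps : R) :
  (0 < N)%N -> (forall i, (i < N)%N -> 0 < theta i) ->
  (forall i, (i < N)%N ->
     theta i ^+ 2 / 2 + theta i * delta i <= tail_sum theta N i / 4) ->
  0 < eps < 1 ->
  exists K mu0, 0 < K /\ forall mu, mu0 <= mu ->
    exists2 E : set T, measurable E &
      (P E <= (K * expR (- ((1 - 2 * eps) * tail_sum theta N 0 * mu)))%:E)%E /\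
      forall w, ~ E w -> {within `[0, +oo[, continuous (fun t => B t w)} ->
        stage_time (fun t => B t w) delta mu N \isn't a fin_num.
Proof.
move=> N0 th0 thV /andP[e0 e1].
have [c c0 cth] := finite_positive_lbound _ _ _ th0.
set V0 := tail_sum theta N 0.
have thV' i : (i < N)%N -> theta i <= tail_sum theta N i.
  by move=> iN; rewrite tail_sum_recl// lerDl tail_sum_ge0.
have VV0 i : (i <= N)%N -> tail_sum theta N i <= V0.
  elim: i => [//|i IH iN]; apply: le_trans (IH (ltnW iN)).
  by rewrite [leRHS]tail_sum_recl// lerDr ltW// th0.
have V00 : 0 < V0 by apply: (lt_le_trans (th0 _ N0)); exact: thV'.
(* The three bounds give, in order, [q >= 1 / 8], a loss in the rate of at most [2 * eps], and
   [2 * eta * V0] at most half of the gain [eps * c ^+ 2 / 2] from the smaller tilts. What remains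
   is at least [k0]. *)
pose eta := Num.min (1 / 16) (Num.min (eps / 4) (eps * c ^+ 2 / (8 * V0))).
have eta0 : 0 < eta.
  by rewrite !lt_min !divr_gt0// ?mulr_gt0// exprn_gt0.
have [eta1 eta2 eta3] : [/\ eta <= 1 / 16, eta <= eps / 4 &
    eta * (8 * V0) <= eps * c ^+ 2].
  rewrite -ler_pdivlMr ?mulr_gt0//; by split; rewrite /eta !ge_min lexx ?orbT.
pose k0 := Num.min (c / 8) (eps * c ^+ 2 / 4).
have k00 : 0 < k0 by rewrite lt_min !divr_gt0// mulr_gt0// exprn_gt0.
have [k01 k02] : k0 <= c / 8 /\ k0 <= eps * c ^+ 2 / 4.
  by rewrite /k0; split; rewrite ge_min lexx ?orbT.
have [K K0 HK] := BM_grid_bound N ((1 - eps) * k0)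
  ltac:(by rewrite mulr_gt0// subr_gt0).
have [mu0 Hmu0] := BM_oscillation_grid eta V0 eta0 V00.
pose C1 := (1 - eps) * \sum_(i < N) theta i * `|delta i|.
pose q := 1 / 4 - 2 * eta.
have K2 : 0 < 2 / (1 - expR (-1)) :> R.
  by rewrite divr_gt0// subr_gt0 expR_lt1 ltrN10.
exists (K * expR C1 + 2 / (1 - expR (-1))), (Num.max mu0 0).
split; first by rewrite addr_gt0// mulr_gt0// expR_gt0.
move=> mu; rewrite ge_max => /andP[mumu0 mu_ge0].
(* Increment required over the grid interval [z, y]: the oscillations at both ends cost at most
   [2 * eta * (mu + y)], and rounding the length costs at most [|delta i|]. *)
pose x (y z : R) i := (1 - 2 * eta) * mu + q * y - delta i * (y - z) - `|delta i|.
have [||E1 mE1 [PE1 HE1]] := HK (fun i => (1 - eps) * theta i) x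
  (C1 - (1 - eps) * (1 - 2 * eta) * V0 * mu).
- by move=> i iN; rewrite mulr_ge0 ?subr_ge0 ?(ltW e1)// ltW// th0.
- move=> p n p0 pn.
  have := sum_by_parts_ge theta delta N q k0 ((1 - eps) / 2) p n _ _ p0 pn.
  set S := \sum_(i < N) _ => HS.
  have {}HS : k0 * p N <= S.
    apply: HS => i iN.
      by have := thV' i iN; have := cth i iN; rewrite /q; nra.
    have := thV i iN; have := thV' i iN; have := cth i iN; have := VV0 i (ltnW iN).
    have : c ^+ 2 <= theta i ^+ 2.
      by rewrite ler_sqr ?nnegrE ?cth// ltW// th0.
    rewrite /q; nra.
  have -> : \sum_(i < N) (((1 - eps) * theta i) ^+ 2 * (p i.+1 - n i) / 2 -
      (1 - eps) * theta i * x (p i.+1) (n i) i) =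
      C1 - (1 - eps) * (1 - 2 * eta) * V0 * mu - (1 - eps) * S.
    rewrite /C1 /V0 /tail_sum big_mkord /S.
    rewrite !mulr_sumr mulr_suml -!sumrB; apply: eq_bigr => i _.
    by rewrite /x; field.
  by rewrite lerD2l lerN2 -mulrA ler_wpM2l// subr_ge0 ltW.
have [E2 mE2 [PE2 HE2]] := Hmu0 mu mumu0.
exists (E1 `|` E2); first exact: measurableU.
have expV : expR (- ((1 - eps) * (1 - 2 * eta) * V0 * mu)) <=
    expR (- ((1 - 2 * eps) * V0 * mu)).
  rewrite ler_expR lerN2 -[leLHS]mulrA -[leRHS]mulrA.
  rewrite ler_wpM2r ?mulr_ge0 ?(ltW V00)//; nra.
split.
  apply: (le_trans (measureU2 P mE1 mE2)).
  rewrite mulrDl EFinD; apply: leeD.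
    apply: (le_trans PE1); rewrite lee_fin expRD mulrA ler_wpM2l//.
    by rewrite mulr_ge0 ?expR_ge0 ?(ltW K0).
  apply: (le_trans PE2); rewrite lee_fin mulrAC ler_wpM2l ?(ltW K2)//.
  rewrite ler_expR lerN2 ler_wpM2r// ler_piMl ?(ltW V00)//; lra.
move=> w nE cb; apply/negP => fin; apply: nE.
have [E2w|nE2] := pselect (E2 w); [by right|left].
have [s [u [s0 su]]] := stage_time_chain _ _ _ _ cb fin.
have sge0 i : (i <= N)%N -> 0 <= s i.
  elim: i => [|i IH] iN; first by rewrite s0.
  have [/andP[a1 a2] _] := su i iN.
  exact: le_trans (IH (ltnW iN)) (le_trans a1 a2).
have tr (z : R) : 0 <= z -> (Num.truncn z)%:R <= z < (Num.truncn z)%:R + 1.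
  by move=> z0; rewrite natr1 truncn_itv.
apply: (HE1 w (fun i => Num.truncn (s i)) (fun i => Num.truncn (u i))).
- by rewrite s0 truncn0.
- by move=> i iN; have [/andP[a1 a2] _] := su i iN; rewrite !le_truncn.
move=> i iN; have [/andP[a1 a2] bsu] := su i iN.
have ui0 : 0 <= u i by apply: le_trans a1; apply: sge0; exact: ltnW.
have t1 := tr _ (sge0 i.+1 iN); have t2 := tr _ ui0.
have := HE2 w nE2 cb _ _ t1; have := HE2 w nE2 cb _ _ t2.
have nm : (Num.truncn (u i) <= Num.truncn (s i.+1))%N by rewrite le_truncn.
have nmR : (Num.truncn (u i))%:R <= (Num.truncn (s i.+1))%:R :> R by rewrite ler_nat.
move: t1 t2; set m := (Num.truncn (s i.+1))%:R; set n := (Num.truncn (u i))%:R.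
move=> /andP[m1 m2] /andP[n1 n2].
rewrite !ler_norml => /andP[h1 h2] /andP[h3 h4].
have hd : delta i * (s i.+1 - u i) <= delta i * (m - n) + `|delta i|.
  rewrite -lerBlDl -mulrBr; apply: (le_trans (ler_norm _)).
  rewrite normrM ler_piMr// ler_norml; apply/andP; split; lra.
move: bsu; rewrite /barrier /x /q -/n -/m => bsu.
have : eta * n <= eta * m by rewrite ler_wpM2l// ltW.
lra.
Qed.

End upper_bound.

(** * Lower bound *)

Lemma finite_eventually (R : realType) (Q : nat -> R -> Prop) (N : nat) :
  (forall i, (i < N)%N -> exists x0, forall x, x0 <= x -> Q i x) ->
  exists x0, forall x, x0 <= x -> forall i, (i < N)%N -> Q i x.
Proof.
elim: N => [|N IH] H; first by exists 0.
have [x0 Hx0] := IH (fun i iN => H i (ltnW iN)).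
have [x1 Hx1] := H N (ltnSn N).
exists (Num.max x0 x1) => x; rewrite ge_max => /andP[xx0 xx1] i.
by rewrite ltnS leq_eqVlt => /predU1P[->|iN]; [exact: Hx1|exact: Hx0].
Qed.

Lemma normal_tail_eventually (R : realType) (theta t eps : R) :
  0 <= theta -> 0 < t -> 0 < eps ->
  exists mu0 : R, forall mu : R, mu0 <= mu -> 0 < mu /\
    ((expR (- ((theta ^+ 2 * t / 2 + eps) * mu)))%:E <=
     normal_prob 0 (Num.sqrt (mu * t)%R) `[(mu * theta * t)%R, +oo[%classic)%E.
Proof.
move=> th0 t0 e0.
(* Half of [eps * mu] covers the lower-order terms of the exponent (second bound), the other half
   the normalizing square root (third bound). *)
exists (Num.max 1 (Num.max (2 * (theta + (2 * t)^-1) / eps) (32 * pi * t / eps ^+ 2))).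
move=> mu; rewrite !ge_max => /andP[mu1 /andP[mu2 mu3]].
have mu0 : 0 < mu by lra.
split=> //.
have mut0 : 0 < mu * t by rewrite mulr_gt0.
have s0 : 0 < Num.sqrt (mu * t) by rewrite sqrtr_gt0.
have x0 : 0 <= mu * theta * t by rewrite !mulr_ge0// ltW.
apply: le_trans (normal_prob_ge _ _ _ s0 x0).
rewrite lee_fin /normal_peak sqr_sqrtr; last exact: ltW.
have h2 : 2 * (theta + (2 * t)^-1) <= mu * eps by rewrite -ler_pdivrMr.
have h3 : 32 * pi * t <= mu * eps ^+ 2 by rewrite -ler_pdivrMr// exprn_gt0.
have -> : - ((theta ^+ 2 * t / 2 + eps) * mu) =
  - (eps * mu / 2) + (- (theta ^+ 2 * t / 2 * mu) - eps * mu / 2) by field.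
rewrite expRD; apply: ler_pM; rewrite ?expR_ge0//.
  rewrite expRN lef_pV2 ?posrE ?expR_gt0//; last first.
    by rewrite sqrtr_gt0 pmulrn_lgt0// mulr_gt0// pi_gt0.
  apply: (@le_trans _ _ (1 + mu * t * pi *+ 2)).
    have a0 : 0 <= mu * t * pi *+ 2 by rewrite mulrn_wge0// mulr_ge0 ?pi_ge0// ltW.
    have := sqr_sqrtr a0; set s := Num.sqrt _; set a := _ *+ _.
    have : 0 <= s by exact: sqrtr_ge0.
    nra.
  have -> : eps * mu / 2 = eps * mu / 4 + eps * mu / 4 by field.
  apply: (@le_trans _ _ ((1 + eps * mu / 4) * (1 + eps * mu / 4))); last first.
    by rewrite expRD ler_pM ?expR_ge1Dx// addr_ge0// divr_ge0// mulr_ge0// ltW.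
  have : mu * (32 * pi * t) <= mu * (mu * eps ^+ 2) by rewrite ler_wpM2l// ltW.
  have : 0 < eps * mu by rewrite mulr_gt0.
  rewrite -mulr_natl; nra.
rewrite ler_expR.
have -> : - (mu * theta * t + 1) ^+ 2 / (2 * (mu * t)) =
    - (theta ^+ 2 * t / 2 * mu) - theta - (2 * t)^-1 / mu.
  by field; rewrite !gt_eqF.
rewrite -addrA lerD2l -opprD lerN2.
have : (2 * t)^-1 / mu <= (2 * t)^-1.
  by rewrite ler_piMr ?invr_ge0 ?mulr_ge0 ?(ltW t0)// invf_le1.
lra.
Qed.

Section lower_bound.
Context {R : realType} {d : measure_display} {T : measurableType d}.
Context {P : probability T R} {B : R -> {RV P >-> R}} (hB : standard_BM B).
Implicit Types (delta theta : nat -> R).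

(* Barrier heights, in units of [mu], at the prescribed hitting times: in stage
   [i] the driving path has slope [theta i], so it reaches the barrier after
   the time [level i / (theta i + delta i - 1 / 4)]. *)
Fixpoint level theta delta (i : nat) : R :=
  if i is j.+1 then
    level theta delta j + level theta delta j / (theta j + delta j - 1 / 4) / 4
  else 1.

Theorem stage_time_lower (N : nat) delta theta (eps : R) :
  (forall i, (i < N)%N -> 0 < theta i) ->
  (forall i, (i < N)%N -> 0 < theta i + delta i - 1 / 4) ->
  (forall i, (i < N)%N ->
     tail_sum theta N i / 4 <= theta i ^+ 2 / 2 + theta i * delta i) ->
  0 < eps ->
  exists mu0, forall mu, mu0 <= mu ->
    exists2 E : set T, measurable E &
      ((expR (- ((tail_sum theta N 0 + eps) * mu)))%:E <= P E)%E /\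
      forall w, E w -> {within `[0, +oo[, continuous (fun t => B t w)} ->
        stage_time (fun t => B t w) delta mu N \is a fin_num.
Proof.
move=> th0 slope thV e0.
set m := level theta delta.
pose L i := m i / (theta i + delta i - 1 / 4).
have mS i : m i.+1 = m i + L i / 4 by [].
have m0 i : (i <= N)%N -> 0 < m i.
  elim: i => [|i IH] iN; first exact: ltr01.
  by rewrite mS addr_gt0 ?divr_gt0 ?IH ?slope// ltnW.
have L0 i : (i < N)%N -> 0 < L i.
  by move=> iN; rewrite divr_gt0 ?slope// m0// ltnW.
have LE i : (i < N)%N -> theta i * L i = m i.+1 - delta i * L i.
  by move=> iN; rewrite mS /L; field; rewrite gt_eqF//; have := slope i iN; lra.
(* Backward induction: by [thV], the product [tail_sum theta N j * m j] drops in each stage by at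
   least the Gaussian cost of that stage. *)
have cost : \sum_(i < N) theta i ^+ 2 * L i / 2 <= tail_sum theta N 0.
  rewrite -(big_mkord xpredT (fun i => theta i ^+ 2 * L i / 2)).
  suff H k : forall j, (j + k)%N = N ->
      \sum_(j <= i < N) theta i ^+ 2 * L i / 2 <= tail_sum theta N j * m j.
    by have := H N 0%N (add0n N); rewrite mulr1.
  elim: k => [|k IH] j; first by rewrite addn0 => ->; rewrite /tail_sum !big_geq// mul0r.
  rewrite addnS -addSn => jk.
  have jN : (j < N)%N by rewrite -jk ltnS leq_addr.
  rewrite big_ltn//; have := IH _ jk; have := thV j jN; rewrite tail_sum_recl//.
  have := LE j jN; rewrite mS; set V := tail_sum _ _ _; set S := \sum_(_ <= _ < _) _.
  move=> h1 h2 h3.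
  have : (theta j + V) / 4 * L j <= (theta j ^+ 2 / 2 + theta j * delta j) * L j.
    by rewrite ler_wpM2r// ltW// L0.
  have h4 : theta j * (theta j * L j) = theta j * (m j + L j / 4 - delta j * L j).
    by rewrite h1.
  lra.
(* Dividing by [N.+1] also covers [N = 0]. *)
pose e' := eps / N.+1%:R.
have e'0 : 0 < e' by rewrite divr_gt0.
have [mu0 Hmu0] := finite_eventually _ _ N (fun i iN =>
  normal_tail_eventually _ (theta i) (L i) e' (ltW (th0 i iN)) (L0 i iN) e'0).
exists (Num.max mu0 1) => mu; rewrite ge_max => /andP[/Hmu0 {}Hmu0 mu1].
have mu_gt0 : 0 < mu by lra.
(* The time at which the barrier has height [mu * m i]. *)
pose t i := mu * (4 * (m i - 1)).
have tS i : t i.+1 - t i = mu * L i by rewrite /t mS; field.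
have t0 : t 0%N = 0 by rewrite /t subrr !mulr0.
have tlt i : (i < N)%N -> t i < t i.+1.
  by move=> iN; rewrite -subr_gt0 tS mulr_gt0// L0.
have tge0 i : (i <= N)%N -> 0 <= t i.
  elim: i => [|i IH] iN; first by rewrite t0.
  exact: le_trans (IH (ltnW iN)) (ltW (tlt i iN)).
pose A i : set R := `[(mu * theta i * L i), +oo[%classic.
have mA i : measurable (A i) by exact: measurable_itv.
exists (\bigcap_(i in `I_N) ((B (t i.+1) \- B (t i)) @^-1` A i)).
  apply: fin_bigcap_measurable; first exact: finite_II.
  by move=> i _; exact: measurable_increment.
split; last first.
  move=> w Ew cb.
  have := stage_time_le (fun t => B t w) delta mu N t cb mu_gt0.
  rewrite t0 lexx => /(_ isT (fun i iN => ltW (tlt i iN))) H.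
  have /H : forall i, (i < N)%N ->
      barrier mu (t i.+1) - delta i * (t i.+1 - t i) <= B (t i.+1) w - B (t i) w.
    move=> i iN; have := Ew i iN; rewrite /A /= in_itv /= andbT; apply: le_trans.
    rewrite tS -[mu * _ * _]mulrA LE// /barrier /t.
    by rewrite le_eqVlt; apply/orP; left; apply/eqP; field.
  have := stage_time_ge0 (fun t => B t w) delta mu N.
  by case: (stage_time _ _ _ _).
have t0_ge0 : 0 <= t 0%N by rewrite t0.
rewrite (@BM_independent _ _ _ _ _ hB N t A t0_ge0 (fun i iN => ltW (tlt i iN)) mA).
apply: (@le_trans _ _ (\prod_(i < N)
    expR (- ((theta i ^+ 2 * L i / 2 + e') * mu)))%:E).
  rewrite -expR_sum lee_fin ler_expR sumrN lerN2 -mulr_suml.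
  rewrite ler_wpM2r ?(ltW mu_gt0)// big_split/= lerD//.
  rewrite sumr_const card_ord -mulr_natr /e' mulrAC ler_pdivrMr//.
  by rewrite ler_wpM2l ?(ltW e0)// ler_nat.
apply: (le_prode _ (fun i => P ((B (t i.+1) \- B (t i)) @^-1` A i))
  (fun i => expR (- ((theta i ^+ 2 * L i / 2 + e') * mu)))) => i iN.
split; first exact: expR_ge0.
rewrite (BM_gaussian hB (tge0 i (ltnW iN)) (tlt i iN) (mA i)) tS.
by have [_] := Hmu0 i iN.
Qed.

End lower_bound.

(** * The optimal slopes *)

Section tilts.
Context {R : realType}.
Implicit Types (a p q : R) (k i : nat).

(* Slope of the driving path in stage [i], for [a = p - q]. *)
Definition tilt p q k i : R :=
  (if odd i then (k - i./2).-1%:R + q else (k - i./2)%:R + p) / 2.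

Lemma tail_sum_recr (theta : nat -> R) N i : (i <= N)%N ->
  tail_sum theta N.+1 i = tail_sum theta N i + theta N.
Proof. by move=> iN; rewrite /tail_sum big_nat_recr. Qed.

(** Counted from the end, the [j]-th pair of stages contributes (2j - 1 + p + q) / 2, the difference
    of consecutive values of j (j + p + q) / 2. *)
Lemma tail_sum_tilt p q k j : (j <= k)%N ->
  tail_sum (tilt p q k) k.*2 (k - j).*2 = j%:R * (j%:R + p + q) / 2.
Proof.
elim: j => [|j IH] jk.
  by rewrite subn0 /tail_sum big_geq// mul0r mul0r.
have i0 : ((k - j.+1).*2 < k.*2)%N by rewrite ltn_double; lia.
have i1 : ((k - j.+1).*2.+1 < k.*2)%N by lia.
rewrite (tail_sum_recl _ _ _ i0) (tail_sum_recl _ _ _ i1).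
have -> : (k - j.+1).*2.+2 = (k - j).*2 by lia.
rewrite IH ?(ltnW jk)// /tilt /= odd_double /= uphalf_double doubleK subKn//.
by rewrite -natr1 /=; field.
Qed.

Lemma tail_sum_tilt0 p q k :
  tail_sum (tilt p q k) k.*2 0 = k%:R * (k%:R + p + q) / 2.
Proof. by have := tail_sum_tilt p q k k (leqnn k); rewrite subnn. Qed.

(** The duality equations up to the excess [p * q / 8]: they are exact when [p * q = 0], and a
    positive excess has the sign that the lower bound allows. *)
Lemma tilt_stage_drift p q k i : (i < k.*2)%N ->
  tilt p q k i ^+ 2 / 2 + tilt p q k i * stage_drift (p - q) i =
  tail_sum (tilt p q k) k.*2 i / 4 + p * q / 8.
Proof.
move=> ik.
pose j := (k - i./2).-1.
have jk : (j < k)%N by rewrite /j; lia.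
have kE : (k - i./2)%N = j.+1 by rewrite /j; lia.
have iE : i = (odd i + (k - j.+1).*2)%N.
  by rewrite -[LHS]odd_double_half /j; congr (_ + _.*2)%N; lia.
have V0 := tail_sum_tilt p q k j.+1 jk.
case oi : (odd i) iE => iE; last first.
  have -> : tail_sum (tilt p q k) k.*2 i = j.+1%:R * (j.+1%:R + p + q) / 2.
    by rewrite iE add0n V0.
  by rewrite /tilt /stage_drift oi kE; field.
have V1 : tail_sum (tilt p q k) k.*2 i = j.+1%:R * (j.+1%:R + p + q) / 2 -
    (j.+1%:R + p) / 2.
  have := tail_sum_recl (tilt p q k) k.*2 (k - j.+1).*2
    ltac:(by rewrite ltn_double; lia).
  rewrite V0 -[(k - j.+1).*2.+1]/(true + (k - j.+1).*2)%N -iE => ->.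
  by rewrite /tilt odd_double doubleK subKn//; ring.
rewrite V1 /tilt /stage_drift oi kE -natr1 /=.
by field.
Qed.

End tilts.

(** * The exponential rate of decay *)

Section rate.
Context {R : realType} {d : measure_display} {T : measurableType d}.
Context {P : probability T R} {B : R -> {RV P >-> R}} (hB : standard_BM B).

Lemma xi_plus_upper (a : R) (k : nat) (eps : R) : (1 <= k)%N -> 0 < eps < 1 ->
  exists K mu0, 0 < K /\ forall mu, mu0 <= mu ->
    exists2 E : set T, measurable E &
      (P E <= (K * expR (- ((1 - 2 * eps) * (k%:R * (`|a| + k%:R) / 2) * mu)))%:E)%E /\
      forall w, ~ E w -> {within `[0, +oo[, continuous (fun t => B t w)} ->
        stage_time (fun t => B t w) (stage_drift a) mu k.*2 \isn't a fin_num.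
Proof.
move=> k1 e01.
(* The positive and negative parts of [a] satisfy [p * q = 0], so there is no excess in the duality
   equations. *)
pose p := Num.max a 0; pose q := Num.max (- a) 0.
have [p0 q0 pq aE pqE] : [/\ 0 <= p, 0 <= q, p * q = 0, a = p - q & p + q = `|a|].
  rewrite /p /q; have [a0|a0] : 0 <= a \/ a < 0 by case: (ltrP a 0); [right|left].
    rewrite (max_l a0) max_r ?oppr_le0// ger0_norm//; split; lra.
  rewrite (max_r (ltW a0)) max_l ?oppr_ge0 ?(ltW a0)// ltr0_norm//; split; lra.
(* The last tilt vanishes if [a >= 0]; that stage is then dropped. *)
pose N := if q == 0 then k.*2.-1 else k.*2.
have N0 : (0 < N)%N by rewrite /N; case: ifP; lia.
have Nk : (N <= k.*2)%N by rewrite /N; case: ifP => // _; exact: leq_pred.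
have tsE i : (i <= N)%N ->
    tail_sum (tilt p q k) N i = tail_sum (tilt p q k) k.*2 i.
  rewrite /N; case: eqP => // q00 iN.
  have -> : k.*2 = k.*2.-1.+1 by rewrite prednK// double_gt0.
  rewrite tail_sum_recr// /tilt /=.
  have -> : odd k.*2.-1 by lia.
  have -> : (k - k.*2.-1./2).-1 = 0%N by lia.
  by rewrite q00; ring.
have tilt0 i : (i < N)%N -> 0 < tilt p q k i.
  move=> iN; rewrite /tilt divr_gt0//; case: ifP => oi; last first.
    by rewrite ltr_wpDr// ltr0n; lia.
  move: iN; rewrite /N; case: eqVneq => [->|q00] iN.
    by rewrite addr0 ltr0n; lia.
  by rewrite ltr_wpDl// lt_neqAle eq_sym q00.
have [i iN|K [mu0 [K0 H]]] :=
    stage_time_upper hB N (stage_drift a) (tilt p q k) eps N0 tilt0 _ e01.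
  rewrite tsE ?(ltnW iN)// {1}aE tilt_stage_drift; last exact: leq_trans iN Nk.
  by rewrite pq mul0r addr0.
exists K, mu0; split=> // mu /H[E mE [PE HE]]; exists E => //; split.
  apply: (le_trans PE); rewrite tsE// tail_sum_tilt0.
  by rewrite (_ : k%:R + p + q = `|a| + k%:R)// -pqE; ring.
move=> w nE cb; have := HE w nE cb; apply: contra.
exact: stage_time_finW.
Qed.

Lemma xi_plus_lower (a : R) (k : nat) (eps : R) : 0 < eps ->
  exists mu0, forall mu, mu0 <= mu ->
    exists2 E : set T, measurable E &
      ((expR (- ((k%:R * (`|a| + k%:R) / 2 + eps) * mu)))%:E <= P E)%E /\
      forall w, E w -> {within `[0, +oo[, continuous (fun t => B t w)} ->
        stage_time (fun t => B t w) (stage_drift a) mu k.*2 \is a fin_num.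
Proof.
move=> e0.
(* Adding [e] to both [p] and [q] keeps [a = p - q] and makes all tilts positive;
   by [tilt_stage_drift] the equations then hold as inequalities. *)
pose e := eps / 2 / k.+1%:R.
have e_gt0 : 0 < e by rewrite !divr_gt0.
pose p := Num.max a 0 + e; pose q := Num.max (- a) 0 + e.
have [p0 q0 aE pqE] : [/\ 0 < p, 0 < q, a = p - q & p + q = `|a| + 2 * e].
  rewrite /p /q; have [a0|a0] : 0 <= a \/ a < 0 by case: (ltrP a 0); [right|left].
    rewrite (max_l a0) max_r ?oppr_le0// ger0_norm//; split; lra.
  rewrite (max_r (ltW a0)) max_l ?oppr_ge0 ?(ltW a0)// ltr0_norm//; split; lra.
have tilt0 i : (i < k.*2)%N -> 0 < tilt p q k i.
  by move=> iN; rewrite /tilt divr_gt0//; case: ifP => _; rewrite ltr_wpDl.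
have [i ik|i ik|mu0 H] :=
    stage_time_lower hB k.*2 (stage_drift a) (tilt p q k) (eps / 2) tilt0 _ _
      ltac:(by rewrite divr_gt0).
(* In both kinds of stages the slope exceeds that of the barrier by at least (p + q) / 4. *)
- rewrite {1}aE /tilt /stage_drift; case: ifP => oi.
    by have := ler0n R (k - i./2).-1; lra.
  have : 1 <= (k - i./2)%:R :> R by rewrite ler1n; lia.
  by lra.
- by rewrite {1}aE tilt_stage_drift// lerDl divr_ge0// mulr_ge0// ltW.
exists (Num.max mu0 0) => mu; rewrite ge_max => /andP[/H[E mE [PE HE]] mu_ge0].
exists E => //; split=> //; apply: le_trans PE.
rewrite lee_fin ler_expR lerN2 ler_wpM2r// tail_sum_tilt0.
have -> : k%:R + p + q = `|a| + k%:R + 2 * e by rewrite -addrA pqE; ring.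
have : k%:R * e <= eps / 2.
  rewrite /e [leLHS]mulrC mulrAC ler_pdivrMr// ler_wpM2l ?ler_nat//.
  by rewrite divr_ge0// ltW.
lra.
Qed.

End rate.

Theorem proposition1p6 (R : realType) (d : measure_display)
    (T : measurableType d) (P : probability T R) (B : R -> {RV P >-> R})
    (hB : standard_BM B) (a : R) (ha : -1 < a) (M : R.-ker T ~> R)
    (hM : is_Ma B a M) (k : nat) (hk : (1 <= k)%N) :
  exists2 eps : R -> R,
    eps mu @[mu --> +oo] --> (0 : R) &
    \forall mu \near +oo,
      P [set w | (k%:R%:E <= M w `[mu, +oo[%classic)%E] =
      (expR (- (k%:R * (`|a| + k%:R) / 2) * mu * (1 + eps mu)))%:E.
Proof.
have k0 : 0 < k%:R :> R by rewrite ltr0n.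
have [I IE] : exists I : R, I = k%:R * (`|a| + k%:R) / 2 by eexists.
have I0 : 0 < I by rewrite IE divr_gt0// mulr_gt0// ltr_wpDl.
pose S mu := [set w | (k%:R%:E <= M w `[mu, +oo[%classic)%E].
have mS mu : measurable (S mu).
  rewrite -[S mu]setTI; apply: emeasurable_fun_c_infty => //.
  exact: measurable_kernel.
pose f mu := fine (P (S mu)).
have fE mu : P (S mu) = (f mu)%:E by rewrite fineK// fin_num_measure.
have [_ Mnu] := hM.
have [NM [mNM PNM HNM]] := Mnu; have [NB [mNB PNB HNB]] := BM_continuous hB.
(* Events are compared off the null sets [NM] and [NB] only, whose union is added at no cost by
   [PN0]. *)
have good w mu : ~ NM w -> ~ NB w -> 0 < mu ->
    {within `[0, +oo[, continuous (fun t => B t w)} /\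
    (S mu w <-> stage_time (fun t => B t w) (stage_drift a) mu k.*2 \is a fin_num).
  move=> nM nB mu0; split; first by apply: contrapT => H; exact/nB/HNB.
  rewrite /S /=.
  have -> : M w `[mu, +oo[%classic = nu (fun t => B t w) a mu `[0, +oo[%classic.
    by move: mu mu0; apply: contrapT => H; exact/nM/HNM.
  exact: le_nu_total.
have PN0 (A : set T) : measurable A -> (P (A `|` (NM `|` NB)) <= P A)%E.
  move=> mA; have mN := measurableU _ _ mNM mNB.
  apply: (le_trans (measureU2 P mA mN)).
  rewrite -[leRHS]adde0 leeD2l//.
  apply: (le_trans (measureU2 P mNM mNB)).
  have [hM0 hB0] : (P NM <= 0)%E /\ (P NB <= 0)%E by rewrite PNM PNB.
  by apply: (le_trans (leeD hM0 hB0)); rewrite adde0.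
have upper e : 0 < e -> exists mu0, forall mu, mu0 <= mu ->
    f mu <= expR (- ((I - e) * mu)).
  (* The loss [2 * eps * I] in the rate is at most [e / 2]; the other [e / 2] absorbs the constant
     [K]. *)
  move=> e0; pose eps := Num.min (1 / 2) (e / (4 * I)).
  have [eps0 eps1 eps2] : [/\ 0 < eps, eps <= 1 / 2 & eps * (4 * I) <= e].
    rewrite -ler_pdivlMr ?mulr_gt0//; split; rewrite /eps ?ge_min ?lexx ?orbT//.
    rewrite lt_min divr_gt0//=; apply: divr_gt0 => //; exact: mulr_gt0.
  have [|K [mu0 [K0 H]]] := xi_plus_upper hB a k eps hk.
    by rewrite eps0; lra.
  rewrite -IE in H.
  exists (Num.max mu0 (Num.max 1 (2 * K / e))) => mu.
  rewrite !ge_max => /andP[/H[E mE [PE HE]] /andP[mu1 muK]].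
  have SE : S mu `<=` E `|` (NM `|` NB).
    move=> w Sw; apply: contrapT => /not_orP[nE /not_orP[nM nB]].
    have [cb Siff] := good w mu nM nB ltac:(lra).
    by have := HE w nE cb; rewrite (Siff.1 Sw).
  rewrite -lee_fin -fE; apply: (le_trans (y := P (E `|` (NM `|` NB)))).
    apply: le_measure; rewrite ?inE//.
    by apply: measurableU => //; exact: measurableU.
  apply: (le_trans (PN0 _ mE)); apply: (le_trans PE); rewrite lee_fin.
  have KE : K <= expR (e / 2 * mu).
    apply: le_trans (expR_ge1Dx _).
    by move: muK; rewrite ler_pdivrMr//; lra.
  apply: (@le_trans _ _ (expR (e / 2 * mu) * expR (- ((1 - 2 * eps) * I * mu)))).
    by rewrite ler_wpM2r ?expR_ge0.
  rewrite -expRD ler_expR.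
  have : 0 <= (e - eps * (4 * I)) * mu by rewrite mulr_ge0 ?subr_ge0//; lra.
  lra.
have lower e : 0 < e -> exists mu0, forall mu, mu0 <= mu ->
    expR (- ((I + e) * mu)) <= f mu.
  move=> e0; have [mu0 H] := xi_plus_lower hB a k e e0; rewrite -IE in H.
  exists (Num.max mu0 1) => mu; rewrite ge_max => /andP[/H[E mE [PE HE]] mu1].
  have SE : E `<=` S mu `|` (NM `|` NB).
    move=> w Ew; have [NMw|nM] := pselect (NM w); first by right; left.
    have [NBw|nB] := pselect (NB w); first by right; right.
    have [cb Siff] := good w mu nM nB ltac:(lra).
    by left; apply: Siff.2; exact: HE.
  rewrite -lee_fin -fE; apply: (le_trans PE); apply: le_trans (PN0 _ (mS mu)).
  apply: le_measure; rewrite ?inE//.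
  by apply: measurableU => //; exact: measurableU.
(* The error term is obtained by solving the claimed identity for it. *)
rewrite -IE; exists (fun mu => - ln (f mu) / (I * mu) - 1).
  apply/cvgrPdist_le => e e0.
  have [mu1 H1] := upper (e * I) ltac:(by rewrite mulr_gt0).
  have [mu2 H2] := lower (e * I) ltac:(by rewrite mulr_gt0).
  exists (Num.max 1 (Num.max mu1 mu2)); split; first exact: num_real.
  move=> mu; rewrite !gt_max => /andP[mu0 /andP[/ltW/H1 h1 /ltW/H2 h2]].
  have f0 : 0 < f mu by apply: lt_le_trans h2; exact: expR_gt0.
  have Imu : 0 < I * mu by rewrite mulr_gt0//; lra.
  rewrite sub0r normrN.
  have -> : - ln (f mu) / (I * mu) - 1 = (- ln (f mu) - I * mu) / (I * mu).
    by field; rewrite !gt_eqF//; lra.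
  rewrite normrM [`|(I * mu)^-1|]gtr0_norm ?invr_gt0// ler_pdivrMr//.
  move: h1 h2; rewrite -{1 2}(lnK f0) !ler_expR => h1 h2.
  rewrite ler_norml; apply/andP; split; lra.
(* The lower bound serves here to make [f mu] positive, so that its logarithm can be inverted. *)
have [mu2 H2] := lower 1 ltr01.
exists (Num.max 1 mu2); split; first exact: num_real.
move=> mu; rewrite gt_max => /andP[mu0 /ltW/H2 h2].
have f0 : 0 < f mu by apply: lt_le_trans h2; exact: expR_gt0.
rewrite fE; congr _%:E.
rewrite (_ : _ * mu * _ = ln (f mu)) ?lnK//.
by field; rewrite !gt_eqF//; lra.
Qed.
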